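(* Let $K \subset L$ be a commutative field extension in which every element of $L$ that is algebraic over $K$ is separable over $K$. Then, for all positive integers $r,s \le \dim_K L$, we have $\mu_{K,L}(r,s) = \kappa_{K,L}(r,s)$.
   Context: For $K$-subspaces $A,B$ of $L$, $\langle AB\rangle$ denotes the $K$-subspace of $L$ spanned by the product set $AB=\{ab \mid a\in A, b\in B\}$. For positive integers $r,s \le \dim_K L$, $\mu_{K,L}(r,s)$ is the minimum of $\dim_K \langle AB\rangle$ over all $K$-subspaces $A,B$ of $L$ with $\dim_K A = r$ and $\dim_K B = s$. The function $\kappa_{K,L}(r,s) = \min_h (\lceil r/h\rceil + \lceil s/h\rceil - 1)h$, where $h=[H:K]$ runs over the set of $K$-dimensions of all finite-dimensional intermediate fields $K \subset H \subset L$. *)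

(* Defs.v *)
From HB Require Import structures.
From mathcomp Require Import all_boot all_order all_algebra all_field.
Set Implicit Arguments. Unset Strict Implicit. Unset Printing Implicit Defensive.
Import GRing.Theory.
Local Open Scope ring_scope.

(* A (commutative) field extension K ⊂ L is modelled by a field embedding
   iota : K -> L (L may be infinite-dimensional over K).  K-subspaces of L
   are predicates on L; all dimensions are K-dimensions. *)
Section Defs.
Variables (K L : fieldType) (iota : {rmorphism K -> L}).

Definition lincomb (c : seq K) (s : seq L) : L :=
  \sum_(i < size s) iota (nth 0 c i) * nth 0 s i.

Definition in_span (s : seq L) (x : L) : Prop := exists c : seq K, x = lincomb c s.

Definition free_over (s : seq L) : Prop :=
  forall c : seq K, lincomb c s = 0 -> forall i, (i < size s)%N -> nth 0 c i = 0.

Definition has_dim (V : L -> Prop) (n : nat) : Prop :=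
  exists b : seq L, size b = n /\ free_over b /\ (forall x, V x <-> in_span b x).

Definition dim_ge (n : nat) : Prop :=
  exists b : seq L, size b = n /\ free_over b.

Definition prod_span (A B : L -> Prop) : L -> Prop :=
  fun x => exists s : seq L,
    (forall y, y \in s -> exists a b, A a /\ B b /\ y = a * b) /\ in_span s x.

Definition intermediate_field (H : L -> Prop) : Prop :=
  [/\ forall k, H (iota k),
      forall x y, H x -> H y -> H (x + y),
      forall x, H x -> H (- x),
      forall x y, H x -> H y -> H (x * y)
    & forall x, H x -> H (x^-1)].

Definition is_mu (r s m : nat) : Prop :=
  (exists A B : L -> Prop, [/\ has_dim A r, has_dim B s & has_dim (prod_span A B) m])
  /\ (forall (A B : L -> Prop) (m' : nat),
        has_dim A r -> has_dim B s -> has_dim (prod_span A B) m' -> (m <= m')%N).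

(* (ceil(r/h) + ceil(s/h) - 1) h, for h >= 1 *)
Definition kappa_term (r s h : nat) : nat :=
  (((r + h).-1 %/ h + (s + h).-1 %/ h).-1 * h)%N.

Definition is_kappa (r s k : nat) : Prop :=
  (exists (H : L -> Prop) (h : nat),
      [/\ intermediate_field H, has_dim H h & k = kappa_term r s h])
  /\ (forall (H : L -> Prop) (h : nat),
        intermediate_field H -> has_dim H h -> (k <= kappa_term r s h)%N).

Definition algebraic_over (x : L) : Prop :=
  exists p : {poly K}, p != 0 /\ root (map_poly iota p) x.

Definition separable_over (x : L) : Prop :=
  exists p : {poly K}, separable_poly p /\ root (map_poly iota p) x.

End Defs.

(* Main.v *)
Require Import Defs.
From HB Require Import structures.
From mathcomp Require Import all_boot all_order all_algebra all_field.
From mathcomp Require Import cyclic boolp zify ring.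
Set Implicit Arguments.
Unset Strict Implicit.
Unset Printing Implicit Defensive.
Import GRing.Theory.
Local Open Scope ring_scope.

(* The lower bound is the linear Kneser theorem: with H the stabilizer of <AB>,
   dim_H <AB> >= dim_H HA + dim_H HB - 1.  After replacing K by H it suffices to
   show that dim <AB> <= dim A + dim B - 2 forces some th outside K to stabilize
   <AB>.  For a nonzero x in A, iterating Dyson's e-transform yields a field
   H_x larger than K with H_x x B inside <AB>.  This is applied over K(t) inside
   L(t) to the generic vector x = sum_i t^i a_i, where (a_i) is a basis of A.
   H_x then contains a polynomial f in L[t] with a coefficient outside K.
   In characteristic p, f^Q is again in H_x for Q = p^e large, and comparing
   coefficients in f^Q x b shows that the f_j^Q stabilize <AB>; by separability
   they are not all in K.  In characteristic 0, H_x is stable under d/dt, hence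
   contains the coefficients of f, which therefore stabilize <AB>.

   For the upper bound, A and B are chosen inside the H-spans of 1, x, ..., x^(c-1)
   and 1, x, ..., x^(d-1), where c = ceil(r/h), d = ceil(s/h) and x has degree at
   least max(c, d) over H; such an x exists by the primitive element theorem. *)

(** * Linear algebra over the image of [iota] *)

Section LinearAlgebra.
Variables (K L : fieldType) (iota : {rmorphism K -> L}).
Implicit Types (s t u v : seq L) (x y z : L) (V W A B : L -> Prop).

Definition subspace V : Prop :=
  [/\ V 0, forall x y, V x -> V y -> V (x + y)
    & forall k x, V x -> V (iota k * x)].

Definition contains V W : Prop := forall x, V x -> W x.

(** Coefficients become functions on [nat], which frees later sums from the lengths of coefficient
    lists. *)
Lemma in_spanP s x :
  in_span iota s x <-> exists c : nat -> K, x = \sum_(i < size s) iota (c i) * s`_i.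
Proof.
split=> [[c ->]|[c ->]]; first by exists (nth 0 c).
exists (mkseq c (size s)); rewrite /lincomb.
by apply: eq_bigr => i _; rewrite nth_mkseq.
Qed.

Lemma free_overP s :
  free_over iota s <->
  forall c : nat -> K, \sum_(i < size s) iota (c i) * s`_i = 0 ->
    forall i, (i < size s)%N -> c i = 0.
Proof.
split=> [fs c c0 i lti | fs c c0 i lti]; last exact: (fs (nth 0 c)).
rewrite -(nth_mkseq 0 c lti); apply: fs => //; rewrite -[RHS]c0.
by apply: eq_bigr => k _; rewrite nth_mkseq.
Qed.

Lemma subspace_sum V n (f : 'I_n -> L) :
  subspace V -> (forall i, V (f i)) -> V (\sum_i f i).
Proof. by case=> V0 VD _ Vf; apply: big_ind. Qed.

Lemma subspaceN V x : subspace V -> V x -> V (- x).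
Proof. by case=> _ _ VZ Vx; rewrite -mulN1r -(rmorphN1 iota); apply: VZ. Qed.

Lemma subspaceB V x y : subspace V -> V x -> V y -> V (x - y).
Proof. by move=> sV Vx Vy; case: (sV) => _ VD _; apply: VD => //; apply: subspaceN. Qed.

Lemma span_sub V s :
  subspace V -> (forall y, y \in s -> V y) -> contains (in_span iota s) V.
Proof.
move=> sV Vs _ /in_spanP[c ->]; apply: subspace_sum => // i.
by case: (sV) => _ _; apply; apply/Vs/mem_nth.
Qed.

Lemma span_subspace s : subspace (in_span iota s).
Proof.
split.
- by apply/in_spanP; exists (fun=> 0); rewrite big1 // => i _; rewrite rmorph0 mul0r.
- move=> x y /in_spanP[c ->] /in_spanP[d ->]; apply/in_spanP.
  exists (fun i => c i + d i); rewrite -big_split; apply: eq_bigr => i _ /=.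
  by rewrite rmorphD mulrDl.
- move=> k x /in_spanP[c ->]; apply/in_spanP; exists (fun i => k * c i).
  by rewrite big_distrr; apply: eq_bigr => i _ /=; rewrite rmorphM mulrA.
Qed.

Lemma span_mem s y : y \in s -> in_span iota s y.
Proof.
move=> ys; apply/in_spanP; exists (fun i => (i == index y s)%:R).
have lts : (index y s < size s)%N by rewrite index_mem.
rewrite (bigD1 (Ordinal lts)) //= eqxx rmorph1 mul1r nth_index // big1 ?addr0 //.
by move=> i /negPf; rewrite -val_eqE /= => ->; rewrite rmorph0 mul0r.
Qed.

Lemma in_span_cat s t x :
  in_span iota (s ++ t) x <->
  exists y z, [/\ in_span iota s y, in_span iota t z & x = y + z].
Proof.
split=> [/in_spanP[c ->]|[y [z [sy tz ->]]]].
  rewrite size_cat big_split_ord /=.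
  set y := \sum_i _; set z := \sum_i _; exists y, z; split=> //; apply/in_spanP.
    exists c; apply: eq_bigr => i _; rewrite nth_cat ifT //.
  exists (fun i => c (size s + i)%N); apply: eq_bigr => i _.
  by rewrite nth_cat ifF ?addKn //; lia.
have [_ sD _] := span_subspace (s ++ t); apply: sD.
  by apply: span_sub sy => [|w ws]; [exact: span_subspace|apply: span_mem; rewrite mem_cat ws].
by apply: span_sub tz => [|w ws]; [exact: span_subspace|apply: span_mem; rewrite mem_cat ws orbT].
Qed.

Lemma free_catP s t :
  free_over iota (s ++ t) <->
  [/\ free_over iota s, free_over iota t
    & forall x, in_span iota s x -> in_span iota t x -> x = 0].
Proof.
have E (c : nat -> K) : \sum_(i < size (s ++ t)) iota (c i) * (s ++ t)`_i =
    \sum_(i < size s) iota (c i) * s`_i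
    + \sum_(i < size t) iota (c (size s + i)%N) * t`_i.
  rewrite size_cat big_split_ord /=; congr (_ + _); apply: eq_bigr => i _.
    by rewrite nth_cat ifT.
  by rewrite nth_cat ifF ?addKn //; lia.
split=> [/free_overP fst|[/free_overP fs /free_overP ft st0]].
  have G (c d : nat -> K) : \sum_(i < size s) iota (c i) * s`_i
      + \sum_(i < size t) iota (d i) * t`_i = 0 ->
      (forall i, (i < size s)%N -> c i = 0) /\ (forall i, (i < size t)%N -> d i = 0).
    move=> cd0; pose e i := if (i < size s)%N then c i else d (i - size s)%N.
    have e0 : \sum_(i < size (s ++ t)) iota (e i) * (s ++ t)`_i = 0.
      rewrite E -[RHS]cd0; congr (_ + _); apply: eq_bigr => i _; rewrite /e ?ltn_ord //.
      by rewrite ifF ?addKn //; lia.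
    split=> i lti.
      by move: (fst _ e0 i); rewrite /e lti size_cat; apply; lia.
    move: (fst _ e0 (size s + i)%N); rewrite /e ifF ?addKn ?size_cat; last by lia.
    by apply; lia.
  split.
  - apply/free_overP => c c0 i lti.
    have [//|+ _] := G c (fun=> 0); last exact.
    by rewrite c0 add0r big1 // => k _; rewrite rmorph0 mul0r.
  - apply/free_overP => c c0 i lti.
    have [//|_] := G (fun=> 0) c; last exact.
    by rewrite c0 addr0 big1 // => k _; rewrite rmorph0 mul0r.
  move=> x /in_spanP[c Dx] /in_spanP[d Dx'].
  have [|c0 _] := G c (fun i => - d i).
    rewrite -Dx {1}Dx' -big_split big1 //= => i _.
    by rewrite rmorphN mulNr addrN.
  by rewrite Dx big1 // => i _; rewrite c0 // rmorph0 mul0r.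
apply/free_overP => c; rewrite E size_cat.
move=> /eqP; rewrite addr_eq0 => /eqP Es.
have s0 : \sum_(i < size s) iota (c i) * s`_i = 0.
  apply: st0; first by apply/in_spanP; exists c.
  rewrite Es; apply: subspaceN; first exact: span_subspace.
  by apply/in_spanP; exists (fun i => c (size s + i)%N).
move/eqP: Es; rewrite s0 eq_sym oppr_eq0 => /eqP t0 i lti.
have [ltis|leis] := ltnP i (size s); first exact: fs.
rewrite -(subnKC leis); apply: (ft (fun i => c (size s + i)%N)) => //.
by lia.
Qed.

Lemma free_take n s : free_over iota s -> free_over iota (take n s).
Proof. by rewrite -{1}(cat_take_drop n s) => /free_catP[]. Qed.

Lemma free1 x : x != 0 -> free_over iota [:: x].
Proof.
move=> nzx; apply/free_overP => c; rewrite /= big_ord1 /= => /eqP.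
by rewrite mulf_eq0 (negPf nzx) orbF fmorph_eq0 => /eqP c0 [].
Qed.

Lemma in_span1 x y : in_span iota [:: x] y <-> exists k, y = iota k * x.
Proof.
split=> [/in_spanP[c ->]|[k ->]]; first by exists (c 0%N); rewrite big_ord1.
by apply/in_spanP; exists (fun=> k); rewrite big_ord1.
Qed.

Lemma free_cons x s :
  free_over iota s -> ~ in_span iota s x -> free_over iota (x :: s).
Proof.
move=> fs sx; have nzx : x != 0.
  by apply/eqP => x0; apply: sx; rewrite x0; case: (span_subspace s).
rewrite -cat1s; apply/free_catP; split=> // [|y /in_span1[k ->] sy].
  exact: free1.
have [->|nzk] := eqVneq k 0; first by rewrite rmorph0 mul0r.
case: sx; have [_ _ sZ] := span_subspace s.
by have := sZ k^-1 _ sy; rewrite fmorphV mulKf ?fmorph_eq0.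
Qed.

(* If s were longer than t, a kernel vector of the coefficient matrix would be a
   relation between the elements of s. *)
Lemma free_size_le s t :
  free_over iota s -> (forall y, y \in s -> in_span iota t y) -> (size s <= size t)%N.
Proof.
move=> /free_overP fs st; rewrite leqNgt; apply/negP => lt_ts.
have /choice[c Dc] : forall i : 'I_(size s), exists c : nat -> K,
    s`_i = \sum_(j < size t) iota (c j) * t`_j.
  by move=> i; apply/in_spanP/st/mem_nth.
pose M := \matrix_(i < size s, j < size t) c i j.
have : kermx M != 0.
  by rewrite -mxrank_eq0 mxrank_ker subn_eq0 -ltnNge (leq_ltn_trans (rank_leq_col _)).
case/rowV0Pn => v /sub_kermxP vM0; apply/negP; rewrite negbK; apply/eqP/rowP => i.
rewrite mxE; have := fs (fun i => if insub i is Some j then v 0 j else 0) _ i (ltn_ord i).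
rewrite valK; apply.
under eq_bigr => k _ do rewrite valK Dc big_distrr /=.
rewrite exchange_big big1 //= => j _.
transitivity (iota ((v *m M) 0 j) * t`_j); last by rewrite vM0 mxE rmorph0 mul0r.
rewrite mxE rmorph_sum big_distrl; apply: eq_bigr => k _ /=.
by rewrite !mxE rmorphM mulrA.
Qed.

(** Vectors of V outside the span of [u] are added one at a time. By [free_size_le] no free family
    in V is longer than [t], so the process stops. *)
Lemma free_extend V t u :
  subspace V -> contains V (in_span iota t) ->
  free_over iota u -> (forall y, y \in u -> V y) ->
  exists v, free_over iota (v ++ u) /\ forall x, V x <-> in_span iota (v ++ u) x.
Proof.
move=> sV Vt; have [n] := ubnP (size t - size u).
elim: n u => // n IHn u le_n fu uV.
have [[x [Vx nux]]|Vu] := pselect (exists x, V x /\ ~ in_span iota u x).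
  have fxu := free_cons fu nux.
  have xuV y : y \in x :: u -> V y by rewrite inE => /predU1P[->//|/uV].
  have := free_size_le fxu (fun y yx => Vt _ (xuV y yx)) => /= le_u.
  have [|v [fv Vv]] := IHn _ _ fxu xuV; first by move: le_n => /=; lia.
  by exists (v ++ [:: x]); rewrite -catA.
exists [::]; split=> // x; split=> [Vx|]; last exact: span_sub.
by apply: contrapT => nux; apply: Vu; exists x.
Qed.

Lemma has_dim_subspace V n : has_dim iota V n -> subspace V.
Proof.
case=> b [_ [_ Vb]]; have [b0 bD bZ] := span_subspace b; split.
- exact/Vb.
- by move=> x y /Vb bx /Vb by_; apply/Vb/bD.
- by move=> k x /Vb bx; apply/Vb/bZ.
Qed.

Lemma has_dim_span s : free_over iota s -> has_dim iota (in_span iota s) (size s).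
Proof. by move=> fs; exists s. Qed.

Lemma has_dim_ext V W n : (forall x, V x <-> W x) -> has_dim iota V n -> has_dim iota W n.
Proof. by move=> VW [b [sb [fb Vb]]]; exists b; split=> //; split=> // x; rewrite -VW. Qed.

Lemma has_dim_sub V t :
  subspace V -> contains V (in_span iota t) ->
  exists2 n, has_dim iota V n & (n <= size t)%N.
Proof.
move=> sV Vt; have [||v []] := @free_extend V t [::] sV Vt => //.
rewrite cats0 => fv Vv; exists (size v); first by exists v.
by apply: free_size_le => // y /span_mem/Vv/Vt.
Qed.

Lemma has_dim_subdim V W n :
  subspace V -> contains V W -> has_dim iota W n -> exists2 m, has_dim iota V m & (m <= n)%N.
Proof.
move=> sV VW [b [<- [fb Wb]]]; apply: has_dim_sub => // x /VW /Wb //.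
Qed.

Lemma has_dim_le V W m n :
  contains V W -> has_dim iota V m -> has_dim iota W n -> (m <= n)%N.
Proof.
move=> VW [b [<- [fb Vb]]] [c [<- [fc Wc]]].
by apply: free_size_le => // y /span_mem/Vb/VW/Wc.
Qed.

Lemma has_dim_eq V W n :
  contains V W -> has_dim iota V n -> has_dim iota W n -> contains W V.
Proof.
move=> VW [b [sb [fb Vb]]] [c [sc [fc Wc]]] x Wx; apply: contrapT => nVx.
have fxb : free_over iota (x :: b) by apply: free_cons => // /Vb.
have : (size (x :: b) <= size c)%N.
  apply: free_size_le => // y; rewrite inE => /predU1P[->|/span_mem/Vb/VW/Wc//]; exact/Wc.
by rewrite /= sb sc ltnn.
Qed.

(** [V (x / c)] says that x lies in cV, and multiplying a basis of V by c gives one of cV. *)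
Lemma has_dim_scale V n c :
  c != 0 -> has_dim iota V n -> has_dim iota (fun x => V (x / c)) n.
Proof.
move=> nzc [b [sb [fb Vb]]]; exists (map ( *%R^~ c) b); rewrite size_map; split=> //.
have E (d : nat -> K) : \sum_(i < size b) iota (d i) * (map ( *%R^~ c) b)`_i =
           (\sum_(i < size b) iota (d i) * b`_i) * c.
  by rewrite big_distrl; apply: eq_bigr => i _; rewrite (nth_map 0) //= mulrA.
split=> [|x].
  apply/free_overP => d; rewrite size_map E => /eqP.
  by rewrite mulf_eq0 (negPf nzc) orbF => /eqP; move/free_overP: fb; apply.
rewrite Vb !in_spanP size_map; split=> -[d Dx]; exists d.
  by rewrite E -Dx mulfVK.
by rewrite Dx E mulfK.
Qed.

Lemma has_dim_unique V m n : has_dim iota V m -> has_dim iota V n -> m = n.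
Proof.
by move=> dm dn; apply/eqP; rewrite eqn_leq (has_dim_le _ dm dn) ?(has_dim_le _ dn dm).
Qed.

Lemma has_dim_gt0 V n x : has_dim iota V n -> V x -> x != 0 -> (0 < n)%N.
Proof.
case=> -[|v vs] [<- [_ Vv]] // /Vv[c ->]; by rewrite /lincomb big_ord0 eqxx.
Qed.

Lemma has_dim_neq0 V n : has_dim iota V n -> (0 < n)%N -> exists2 x, V x & x != 0.
Proof.
move=> dV n_gt0; apply: contrapT => nex.
have : (n <= 0)%N; last by rewrite leqNgt n_gt0.
apply: (has_dim_le _ dV (has_dim_span (s := [::]) _)) => // x Vx.
have -> : x = 0 by apply/eqP; apply: contrapT => /negP nzx; apply: nex; exists x.
by case: (span_subspace [::]).
Qed.

(** Dividing a relation between the x^i v by v gives a polynomial vanishing at x. The factor v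
    serves when only the products x^i v are known to lie in a small space. *)
Lemma nonfree_powers m x (v : L) :
  v != 0 -> ~ free_over iota (mkseq (fun i => x ^+ i * v) m) ->
  exists p : {poly K}, [/\ p != 0, (size p <= m)%N & root (map_poly iota p) x].
Proof.
move=> nzv nfree; apply: contrapT => nex; apply/nfree/free_overP => c.
rewrite size_mkseq => c0 i lti; apply/eqP; apply: contrapT => /negP nzc.
apply: nex; exists (\poly_(i < m) c i); split; last 2 first.
- exact: size_poly.
- apply/rootP/(mulIf nzv); rewrite mul0r -[RHS]c0.
  rewrite (@horner_coef_wide _ m) ?size_map_poly ?size_poly // big_distrl.
  by apply: eq_bigr => k _; rewrite coef_map coef_poly ltn_ord nth_mkseq // mulrA.
apply: contraNneq nzc => /(congr1 (fun q : {poly K} => q`_i)).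
by rewrite coef_poly lti coef0 => ->.
Qed.

Lemma has_dim_algebraic V n x :
  has_dim iota V n -> (forall i, V (x ^+ i)) -> algebraic_over iota x.
Proof.
move=> [vs [szv [fv Vv]]] Vx.
have [|p [nzp _ px]] := @nonfree_powers n.+1 x 1 (oner_neq0 _); last by exists p.
move=> /(@free_size_le _ vs) le_n; suff /le_n: forall y,
    y \in mkseq (fun i => x ^+ i * 1) n.+1 -> in_span iota vs y.
  by rewrite size_mkseq szv ltnn.
by move=> y /mapP[i _ ->]; rewrite mulr1; apply/Vv.
Qed.

Definition add_space A B x := exists y z, [/\ A y, B z & x = y + z].

(** A basis u of the intersection extends to bases v ++ u of A and w ++ u of B, and w ++ v ++ u is
    then a basis of A + B. *)
Lemma has_dim_add A B a b :
  has_dim iota A a -> has_dim iota B b ->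
  exists i j : nat, [/\ has_dim iota (fun x => A x /\ B x) i,
    has_dim iota (add_space A B) j & (a + b = i + j)%N].
Proof.
move=> dA dB; have [sA sB] := (has_dim_subspace dA, has_dim_subspace dB).
have sI : subspace (fun x => A x /\ B x).
  case: sA sB => A0 AD AZ [B0 BD BZ]; split=> // [x y [? ?] [? ?]|k x [? ?]].
    by split; [exact: AD|exact: BD].
  by split; [exact: AZ|exact: BZ].
case: dA dB => ba [sza [fa Aa]] [bb [szb [fb Bb]]].
have [|i [u [szu [fu Iu]]] _] := @has_dim_sub (fun x => A x /\ B x) ba sI.
  by move=> x [/Aa].
have uA y : y \in u -> A y by move/span_mem/Iu=> [].
have uB y : y \in u -> B y by move/span_mem/Iu=> [].
have [x /Aa//|v [fv Av]] := @free_extend A ba u sA _ fu uA.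
have [x /Bb//|w [fw Bw]] := @free_extend B bb u sB _ fu uB.
have dA : has_dim iota A (size (v ++ u)) by exists (v ++ u).
have dB : has_dim iota B (size (w ++ u)) by exists (w ++ u).
have Ea : a = size (v ++ u).
  have dA' : has_dim iota A a by exists ba.
  by apply/eqP; rewrite eqn_leq (has_dim_le _ dA' dA) ?(has_dim_le _ dA dA').
have Eb : b = size (w ++ u).
  have dB' : has_dim iota B b by exists bb.
  by apply/eqP; rewrite eqn_leq (has_dim_le _ dB' dB) ?(has_dim_le _ dB dB').
exists i, (size (w ++ (v ++ u))); split.
- by exists u.
- exists (w ++ v ++ u); split=> //; split.
    apply/free_catP; split=> // [|x wx vux]; first by case/free_catP: fw.
    have Ax : A x by apply/Av.
    have Bx : B x.
      apply/Bw/in_span_cat; exists x, 0; rewrite addr0; split=> //.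
      by case: (span_subspace u).
    have /Iu ux : A x /\ B x by [].
    by case/free_catP: fw => _ _; apply.
  move=> x; rewrite in_span_cat; split.
    case=> y [z [Ay /Bw/in_span_cat[p [q [wp uq ->]]] ->]].
    exists p, (y + q); split=> //; last by rewrite addrCA.
    apply/Av; case: (sA) => _ AD _; apply: AD => //.
    by apply: span_sub uq => // ? /uA.
  case=> y [z [wy /Av Az ->]]; exists z, y; split=> //; last by rewrite addrC.
  apply/Bw/in_span_cat; exists y, 0; rewrite addr0; split=> //.
  by case: (span_subspace u).
by rewrite Ea Eb !size_cat -szu; lia.
Qed.

End LinearAlgebra.

(** * Stabilizers and Dyson's e-transform *)

Section Stabilizer.
Variables (K L : fieldType) (iota : {rmorphism K -> L}).
Implicit Types (x y z : L) (V W A B : L -> Prop).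

Definition stabilizer V x := forall y, V y -> V (x * y).

(** Closure under inverses comes from finite dimension: for nonzero x, xV lies in V and has the same
    dimension, so xV = V. *)
Lemma stabilizer_field V n :
  has_dim iota V n -> intermediate_field iota (stabilizer V).
Proof.
move=> dV; have sV := has_dim_subspace dV; have [V0 VD VZ] := sV; split.
- by move=> k y; apply: VZ.
- by move=> x y sx sy z Vz; rewrite mulrDl; apply: VD; [apply: sx|apply: sy].
- by move=> x sx y Vy; rewrite mulNr; apply: (subspaceN sV); apply: sx.
- by move=> x y sx sy z Vz; rewrite -mulrA; apply/sx/sy.
move=> x sx y Vy; have [->|nzx] := eqVneq x 0; first by rewrite invr0 mul0r.
have VxV : contains (fun z => V (z / x)) V.
  by move=> z /sx; rewrite mulrC divfK.
rewrite mulrC; exact: (has_dim_eq VxV (has_dim_scale nzx dV) dV).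
Qed.

Lemma field_subspace H : intermediate_field iota H -> subspace iota H.
Proof.
case=> HK HD _ HM _; split=> //; first by rewrite -(rmorph0 iota).
by move=> k x Hx; apply: HM.
Qed.

Lemma field_X H x i : intermediate_field iota H -> H x -> H (x ^+ i).
Proof.
case=> HK _ _ HM _ Hx; elim: i => [|i IHi]; first by rewrite expr0 -(rmorph1 iota).
by rewrite exprS; apply: HM.
Qed.

(* Dyson's e-transform replaces (A, B) by (A ∩ e^-1 B, B + e A); it shrinks A
   unless A B ⊆ B, in which case the stabilizer of B contains A. *)
Lemma e_transform a A B W b w :
  has_dim iota A a -> has_dim iota B b -> has_dim iota W w -> A 1 ->
  (forall x y, A x -> B y -> W (x * y)) -> (w + 2 <= a + b)%N ->
  exists H : L -> Prop, [/\ intermediate_field iota H,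
    exists2 th, H th & forall k, th <> iota k
    & forall x y, H x -> B y -> W (x * y)].
Proof.
have [n] := ubnP a; elim: n a A B b => // n IHn a A B b.
move=> lt_a dA dB dW A1 ABW le_w.
have [[sA sB] sW] := (has_dim_subspace dA, has_dim_subspace dB, has_dim_subspace dW).
have [[e [Be [x [Ax nBxe]]]]|stabAB] :=
    pselect (exists e, B e /\ exists x, A x /\ ~ B (x * e)); last first.
  have AB x : A x -> stabilizer B x.
    move=> Ax y By; apply: contrapT => nBxy.
    by apply: stabAB; exists y; split=> //; exists x.
  exists (stabilizer B); split; first exact: stabilizer_field dB.
    (* If A lay in K, then a <= 1, while b <= w because 1 is in A; this contradicts w + 2 <= a +
       b. *)
    apply: contrapT => nth; suff: (a <= 1)%N.
      have: (b <= w)%N by apply: (has_dim_le _ dB dW) => y /(ABW _ _ A1); rewrite mul1r.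
      lia.
    apply: (has_dim_le _ dA (has_dim_span (@free1 _ _ iota 1 (oner_neq0 _)))) => x Ax.
    apply/in_span1; apply: contrapT => nK; apply: nth; exists x; first exact: AB.
    by move=> k Dx; apply: nK; exists k; rewrite mulr1.
  move=> x y sx By; rewrite -[_ * _]mul1r; apply: (ABW _ _ A1); exact: sx.
have nze : e != 0.
  by apply/eqP => e0; apply: nBxe; rewrite e0 mulr0; case: sB.
(* The dimensions of the intersection and of the sum of B and eA again add up to a + b, so the bound
   on w survives. *)
have [i [j [dI dS Eij]]] := has_dim_add dB (has_dim_scale nze dA).
pose A' y := A y /\ B (y * e).
have dA' : has_dim iota A' i.
  have nzei : e^-1 != 0 by rewrite invr_eq0.
  apply: has_dim_ext (has_dim_scale nzei dI) => y; rewrite invrK mulfK //.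
  by split=> -[].
have lt_i : (i < a)%N.
  have le_ia : (i <= a)%N by apply: (has_dim_le _ dA' dA) => y [].
  rewrite ltn_neqAle le_ia andbT; apply/eqP => Ei; rewrite Ei in dA'.
  have /(_ _ x Ax) := has_dim_eq _ dA' dA.
  by case=> [y []|_ /nBxe].
have [||||H [fH thH HBW]] := IHn i A' _ j _ dA' dS dW _ _ _.
- exact: leq_trans lt_i _.
- by split=> //; rewrite mul1r.
- move=> y _ [Ay Bye] [p [q [Bp Aq ->]]]; case: (sW) => _ WD _.
  rewrite mulrDr; apply: WD; first exact: ABW.
  (* By commutativity the product of y in A' and q in eA is also that of q/e in A and ye in B. *)
  have -> : y * q = (q / e) * (y * e) by rewrite mulrCA divfK.
  exact: ABW.
- by rewrite -Eij addnC; lia.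
exists H; split=> // y z Hy Bz; apply: HBW => //.
exists z, 0; split=> //; rewrite ?addr0 // mul0r; by case: sA.
Qed.

(** Passing from A, B to x^-1 A, xB puts 1 in the first space and leaves the set of products
    unchanged. *)
Lemma e_transform_at a b w A B W x :
  has_dim iota A a -> has_dim iota B b -> has_dim iota W w -> A x -> x != 0 ->
  (forall x y, A x -> B y -> W (x * y)) -> (w + 2 <= a + b)%N ->
  exists H : L -> Prop, [/\ intermediate_field iota H,
    exists2 th, H th & forall k, th <> iota k
    & forall h y, H h -> B y -> W (h * (x * y))].
Proof.
move=> dA dB dW Ax nzx ABW le_w.
have nzxi : x^-1 != 0 by rewrite invr_eq0.
have [||H [fH thH HBW]] :=
  e_transform (has_dim_scale nzxi dA) (has_dim_scale nzx dB) dW _ _ le_w.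
- by rewrite invrK mul1r.
- move=> y z; rewrite invrK => Ay Bz.
  by rewrite -(divfK nzx z) [_ * x]mulrC mulrA; apply: ABW.
exists H; split=> // h y Hh By; apply: HBW => //.
by rewrite mulrC mulKf.
Qed.

End Stabilizer.

(** * Subfields given by predicates, turned into field types *)

Definition is_subfield (L : fieldType) (P : L -> Prop) : Prop :=
  [/\ P 1, forall x y, P x -> P y -> P (x - y)
    & forall x y, P x -> P y -> P (x / y)].

Section SubfieldType.
Variables (L : fieldType) (P : L -> Prop) (subP : is_subfield P).

(** The proof that P is a subfield is an argument of the predicate so that the closure instance
    below can be attached to it. *)
Definition subfield_pred of is_subfield P : {pred L} := fun x => `[< P x >].

Fact subfield_pred_closed : divring_closed (subfield_pred subP).
Proof.
case: (subP) => P1 PB PV; split.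
- exact/asboolP.
- by move=> x y /asboolP Px /asboolP Py; apply/asboolP/PB.
- by move=> x y /asboolP Px /asboolP Py; apply/asboolP/PV.
Qed.

HB.instance Definition _ := GRing.isDivringClosed.Build L (subfield_pred subP)
  subfield_pred_closed.

Record subfield_type := SubfieldElt {
  subfield_val : L; _ : subfield_val \in subfield_pred subP }.

HB.instance Definition _ := [isSub for subfield_val].
HB.instance Definition _ := [Choice of subfield_type by <:].
HB.instance Definition _ := [SubChoice_isSubComUnitRing of subfield_type by <:].
HB.instance Definition _ := [SubComUnitRing_isSubIntegralDomain of subfield_type by <:].
HB.instance Definition _ := [SubIntegralDomain_isSubField of subfield_type by <:].

(** This lets an intermediate field, or K(t) inside L(t), serve as a new base field. *)
Lemma subfield_embedding : exists (F : fieldType) (j : {rmorphism F -> L}),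
  forall x, P x <-> exists k, x = j k.
Proof.
exists subfield_type, (val : {rmorphism subfield_type -> L}) => x.
split=> [/asboolP Px|[[y /= /asboolP Py] ->] //].
by exists (SubfieldElt Px).
Qed.

End SubfieldType.

Lemma intermediate_subfield (K L : fieldType) (iota : {rmorphism K -> L}) H :
  intermediate_field iota H -> is_subfield H.
Proof.
case=> HK HD HN HM HV; split; first by rewrite -(rmorph1 iota).
  by move=> x y Hx Hy; apply/HD/HN.
by move=> x y Hx Hy; apply/HM/HV.
Qed.

(** * Dimensions in a tower of fields *)

Section Tower.
Variables (K F L : fieldType) (iota : {rmorphism K -> L}) (j : {rmorphism F -> L}).
Variable H : L -> Prop.
Hypothesis HE : forall x, H x <-> exists k, x = j k.

(** Each v contributes a K-basis of Hv. The lines Hv are independent, so these bases concatenate to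
    a free family. *)
Lemma tower_span h vs : has_dim iota H h -> free_over j vs ->
  exists b, [/\ size b = (size vs * h)%N, free_over iota b
    & forall x, in_span iota b x <-> in_span j vs x].
Proof.
move=> dH; elim: vs => [_|v vs IHv].
  by exists [::]; split=> // x; split=> -[c ->]; exists [::]; rewrite /lincomb !big_ord0.
rewrite -cat1s => /free_catP[fv /IHv[b [sb fb Eb]] v_vs].
have nzv : v != 0.
  apply/eqP => v0; have /free_overP/(_ (fun=> 1)) := fv.
  rewrite big_ord1 /= v0 mulr0 => /(_ erefl 0%N erefl) /eqP; by rewrite oner_eq0.
have [b1 [sb1 [fb1 Eb1]]] := has_dim_scale nzv dH.
have Ev x : in_span iota b1 x <-> in_span j [:: v] x.
  rewrite -Eb1 HE in_span1; split=> -[k Dk]; exists k; first by rewrite -Dk divfK.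
  by rewrite Dk mulfK.
exists (b1 ++ b); split.
- by rewrite size_cat sb1 sb mulSn.
- by apply/free_catP; split=> // x /Ev ? /Eb ?; apply: v_vs.
move=> x; rewrite !in_span_cat; split=> -[y [z [? ? ->]]]; exists y, z.
  by split=> //; [apply/Ev|apply/Eb].
by split=> //; [apply/Ev|apply/Eb].
Qed.

Lemma tower_dim h V d : has_dim iota H h -> has_dim j V d -> has_dim iota V (d * h)%N.
Proof.
move=> dH [vs [<- [fvs Vvs]]]; have [b [sb fb Eb]] := tower_span dH fvs.
by exists b; split=> //; split=> // x; rewrite Vvs Eb.
Qed.

Hypothesis HK : forall k, H (iota k).

Lemma span_tower s : contains (in_span iota s) (in_span j s).
Proof.
have [s0 sD sZ] := span_subspace j s.
apply: span_sub => [|y]; last exact: span_mem.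
split=> // k x sx; have /HE[l ->] := HK k; exact: sZ.
Qed.

End Tower.

(** * Fractions of polynomials in lowest terms *)

Local Notation "p %:F" := (@FracField.tofrac _ p) (at level 1, format "p %:F") : ring_scope.

Lemma fraction_div (R : idomainType) (z : {fraction R}) :
  exists n d : R, d != 0 /\ z = n%:F / d%:F.
Proof.
elim/quotW: z => r; have nzd := denom_ratioP r.
exists (frac r).1, (frac r).2; split=> //.
apply: (canRL (mulfK _)); first by rewrite tofrac_eq0.
unlock FracField.tofrac; rewrite -[LHS]FracField.pi_mul; apply/eqmodP.
by rewrite /= FracField.equivfE /FracField.mulf /= !numden_Ratio ?mulr1 ?mul1r ?oner_neq0 // mulrC.
Qed.

Lemma fraction_coprime (L : fieldType) (z : {fraction {poly L}}) :
  exists n d : {poly L}, [/\ d != 0, coprimep d n & z = n%:F / d%:F].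
Proof.
have [n [d [nzd ->]]] := fraction_div z.
have nzg : gcdp d n != 0 by rewrite gcdp_eq0 (negPf nzd).
have Ed := divpK (dvdp_gcdl d n); have En := divpK (dvdp_gcdr d n).
exists (n %/ gcdp d n), (d %/ gcdp d n); split.
- by apply: contraNneq nzd => d0; rewrite -Ed d0 mul0r.
- by apply: coprimep_div_gcd; rewrite nzd.
rewrite -{1}Ed -{1}En !tofracM -mulf_div divff ?mulr1 //.
by rewrite tofrac_eq0.
Qed.

(** * Extension of scalars from K to K(t) *)

(* M stands for L(t), T for the inclusion of L[t] in it, frac_poly and frac_const
   for those of K[t] and L, and j for K(t) -> L(t). *)
Section RationalFunctions.
Variables (K L : fieldType) (iota : {rmorphism K -> L}).
Variables (M : fieldType) (T : {rmorphism {poly L} -> M}).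
Hypothesis T_eq0 : forall f, (T f == 0) = (f == 0).
Implicit Types (P Q D : {poly K}) (f g : {poly L}) (z : M).

Variables (frac_poly : {rmorphism {poly K} -> M}) (frac_const : {rmorphism L -> M}).
Hypothesis frac_polyE : forall P, frac_poly P = T (map_poly iota P).
Hypothesis frac_constE : forall x, frac_const x = T x%:P.

Lemma frac_inj : injective T.
Proof. by apply: raddf_inj => f /eqP; rewrite T_eq0 => /eqP. Qed.

Lemma frac_poly_eq0 P : (frac_poly P == 0) = (P == 0).
Proof. by rewrite frac_polyE T_eq0 map_poly_eq0. Qed.

Lemma frac_poly_inj : injective frac_poly.
Proof. by apply: raddf_inj => P /eqP; rewrite frac_poly_eq0 => /eqP. Qed.

(** This is K(t) as a subset of L(t). *)
Definition rational z : Prop := exists P Q, Q != 0 /\ z = frac_poly P / frac_poly Q.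

Lemma rational_subfield : is_subfield rational.
Proof.
split.
- by exists 1, 1; rewrite oner_neq0 rmorph1 divr1.
- move=> _ _ [P [Q [nzQ ->]]] [P' [Q' [nzQ' ->]]].
  exists (P * Q' - P' * Q), (Q * Q'); split; first exact: mulf_neq0.
  by rewrite -mulNr addf_div ?frac_poly_eq0 // rmorphB !rmorphM mulNr.
- move=> _ _ [P [Q [nzQ ->]]] [P' [Q' [nzQ' ->]]].
  have [P'0|nzP'] := eqVneq P' 0.
    by exists 0, 1; rewrite oner_neq0 P'0 !rmorph0 !mul0r invr0 mulr0.
  exists (P * Q'), (Q * P'); split; first exact: mulf_neq0.
  by rewrite invf_div mulf_div !rmorphM.
Qed.

Variables (Kt : fieldType) (j : {rmorphism Kt -> M}).
Hypothesis jE : forall z, rational z <-> exists k, z = j k.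

Lemma frac_poly_rational P : exists k, frac_poly P = j k.
Proof. by apply/jE; exists P, 1; rewrite oner_neq0 rmorph1 divr1. Qed.

Lemma common_denominator (c : nat -> Kt) n :
  exists D (p : nat -> {poly K}), D != 0 /\
    forall i, (i < n)%N -> frac_poly D * j (c i) = frac_poly (p i).
Proof.
elim: n => [|n [D [p [nzD Dp]]]]; first by exists 1, (fun=> 0); rewrite oner_neq0.
have /jE[P [Q [nzQ Dc]]] : exists k, j (c n) = j k by exists (c n).
exists (D * Q), (fun i => if i == n then D * P else Q * p i); split=> [|i].
  exact: mulf_neq0.
rewrite ltnS leq_eqVlt /=; case: eqP => [-> _|_ /= /Dp Ei].
  by rewrite Dc !rmorphM -mulrA [_ / _]mulrC mulVKf ?frac_poly_eq0.
by rewrite !rmorphM -Ei mulrCA mulrA.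
Qed.

(** Let D_v be the lowest nonzero coefficient of D. Coefficient v + i of D f is D_v f_i plus a
    K-combination of the f_k with k < i, so induction on i applies. *)
Lemma coef_denominator (W : L -> Prop) D f :
  subspace iota W -> D != 0 -> (forall i, W (map_poly iota D * f)`_i) -> forall i, W f`_i.
Proof.
move=> sW nzD WDf.
have /ex_minnP[v nzv minv] : exists v, D`_v != 0.
  by exists (size D).-1; rewrite -/(lead_coef D) lead_coef_eq0.
elim/ltn_ind=> i IHi; have [W0 WD WZ] := sW.
have := WDf (v + i)%N; rewrite coefM (bigD1 (inord v)) //= inordK; last by lia.
set S := \sum_(_ < _ | _) _ => WS.
have {}WS : W (iota D`_v * f`_i).
  rewrite -(addrK S (_ * _)); apply: (subspaceB sW); first by rewrite coef_map addKn in WS.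
  apply: big_ind => // k nek; rewrite coef_map; have [ltkv|lekv] := ltnP k v.
    have -> : D`_k = 0 by apply/eqP; apply: contraTT ltkv => /minv; rewrite -leqNgt.
    by rewrite raddf0 mul0r.
  apply/WZ/IHi; have : (k : nat) != v.
    by apply: contraNneq nek => Ek; apply/eqP/val_inj; rewrite /= inordK; lia.
  by have := ltn_ord k; lia.
by have := WZ (D`_v)^-1 _ WS; rewrite fmorphV mulKf // fmorph_eq0.
Qed.

(** After multiplication by a common denominator D the coefficients in t can be compared;
    [coef_denominator] then removes D. *)
Lemma span_const_coef ws f :
  in_span j (map frac_const ws) (T f) -> forall i, in_span iota ws f`_i.
Proof.
case/in_spanP=> c; rewrite size_map => Ef.
have [D [p [nzD Dp]]] := common_denominator c (size ws).
apply: (coef_denominator (span_subspace iota ws) nzD) => i.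
suff -> : map_poly iota D * f = \sum_(k < size ws) map_poly iota (p k) * (ws`_k)%:P.
  rewrite coef_sum; apply/in_spanP; exists (fun k => (p k)`_i).
  by apply: eq_bigr => k _; rewrite coefMC coef_map.
apply: frac_inj; rewrite rmorphM -frac_polyE Ef big_distrr rmorph_sum.
apply: eq_bigr => k _; rewrite (nth_map 0) //= mulrA rmorphM.
by rewrite -frac_polyE -frac_constE Dp.
Qed.

(** A relation over K(t), cleared of denominators, gives one relation over K for each power of t. *)
Lemma free_const s : free_over iota s -> free_over j (map frac_const s).
Proof.
move=> /free_overP fs; apply/free_overP => c; rewrite size_map => c0.
have [D [p [nzD Dp]]] := common_denominator c (size s).
have p0 : \sum_(k < size s) map_poly iota (p k) * (s`_k)%:P = 0.
  apply: frac_inj; rewrite rmorph_sum rmorph0.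
  transitivity (frac_poly D * \sum_(i < size s) j (c i) * (map frac_const s)`_i);
    last by rewrite c0 mulr0.
  rewrite big_distrr; apply: eq_bigr => k _; rewrite (nth_map 0) //= mulrA rmorphM.
  by rewrite -frac_polyE -frac_constE Dp.
move=> i lti; apply/eqP; rewrite -(fmorph_eq0 j).
have /eqP : frac_poly D * j (c i) = 0.
  rewrite Dp //; apply/eqP; rewrite frac_poly_eq0; apply/eqP/polyP => k; rewrite coef0.
  apply: (fs (fun i => (p i)`_k)) => //.
  have := congr1 (fun q : {poly L} => q`_k) p0; rewrite coef0 coef_sum => E0; rewrite -[RHS]E0.
  by apply: eq_bigr => m _; rewrite coefMC coef_map.
by rewrite mulf_eq0 frac_poly_eq0 (negPf nzD).
Qed.

(* As in the rational root theorem, the denominator of z divides the leading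
   coefficient of P. *)
Hypothesis T_frac : forall z, exists n d : {poly L}, [/\ d != 0, coprimep d n & z = T n / T d].

Lemma algebraic_denominator z (P : {poly {poly K}}) :
  P != 0 -> root (map_poly frac_poly P) z ->
  exists D f, D != 0 /\ frac_poly D * z = (T f).
Proof.
move=> nzP Pz; have [u [v [nzv cop Dz]]] := T_frac z.
exists (lead_coef P); rewrite lead_coef_eq0.
have nzvF : T v != 0 by rewrite T_eq0.
pose n := (size P).-1.
have Esz : size P = n.+1 by rewrite /n prednK // lt0n size_poly_eq0.
have rel : \sum_(i < n.+1) map_poly iota P`_i * u ^+ i * v ^+ (n - i) = 0.
  apply: frac_inj; rewrite rmorph_sum rmorph0.
  transitivity (T v ^+ n * (map_poly frac_poly P).[z]); last by rewrite (eqP Pz) mulr0.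
  rewrite (@horner_coef_wide _ n.+1) ?big_distrr; last first.
    by rewrite -Esz size_map_inj_poly ?rmorph0 //; apply: frac_poly_inj.
  apply: eq_bigr => i _ /=; rewrite !rmorphM !rmorphXn coef_map /= Dz expr_div_n.
  have -> : T v ^+ n = T v ^+ (n - i) * T v ^+ i by rewrite -exprD subnK // leq_ord.
  by rewrite frac_polyE mulrACA [T v ^+ i * _]mulrC divfK ?expf_neq0 // mulrC mulrA.
have /dvdpP[q Eq] : v %| map_poly iota (lead_coef P).
  rewrite -(@Gauss_dvdpl _ _ (u ^+ n) v); last exact: coprimep_expr.
  move: rel; rewrite big_ord_recr /= subnn mulr1 => /eqP.
  rewrite addr_eq0 => /eqP/(congr1 -%R); rewrite opprK => <-.
  rewrite dvdpNr; apply: (big_ind (fun q => v %| q)); rewrite ?dvdp0 //.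
    by move=> x y; apply: dvdp_add.
  move=> i _; rewrite dvdp_mull // -(subnSK (ltn_ord i)) exprS dvdp_mulr //.
exists (q * u); split=> //.
by rewrite frac_polyE Eq Dz !rmorphM mulrA mulrAC mulfK // mulrC.
Qed.

(** * Descent from a field inside L(t) to coefficients in L *)

Section Descent.
Variables (H : M -> Prop) (ra bs ws : seq L).
Hypothesis fieldH : intermediate_field j H.
Hypothesis HW : forall h b, H h -> b \in bs ->
  in_span j (map frac_const ws) (h * (T (Poly ra) * frac_const b)).
Hypothesis nz_ra : Poly ra != 0.
Hypothesis nz_bs : exists2 b, b \in bs & b != 0.

Lemma frac_poly_mem P : H (frac_poly P).
Proof. by have [k ->] := frac_poly_rational P; case: fieldH. Qed.

Lemma horner_mem (P : {poly {poly K}}) z : H z -> H (map_poly frac_poly P).[z].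
Proof.
move=> Hz; case: fieldH => HK HD _ HM _.
rewrite horner_coef; apply: big_ind => // [|i _]; first by rewrite -(rmorph0 j).
by rewrite coef_map; apply: HM; [exact: frac_poly_mem|exact: field_X fieldH Hz].
Qed.

(** With y the product of [Poly ra] and some nonzero b, all z^i y lie in a K(t)-space spanned by
    [size ws] vectors, so z is algebraic over K(t). Clearing denominators moves the relation to
    K[t]. *)
Lemma mem_algebraic z : H z ->
  exists2 P : {poly {poly K}}, P != 0 & root (map_poly frac_poly P) z.
Proof.
move=> Hz; have [b bs_b nzb] := nz_bs; pose y := T (Poly ra) * frac_const b.
have nzy : y != 0 by rewrite mulf_neq0 ?T_eq0 ?fmorph_eq0.
have [|p [nzp _ pz]] := @nonfree_powers _ _ j (size ws).+1 z y nzy.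
  move=> /(@free_size_le _ _ _ _ (map frac_const ws)) le_ws.
  rewrite size_mkseq size_map ltnn in le_ws; apply: notF; apply: le_ws => w /mapP[i _ ->].
  by apply: HW => //; apply: field_X fieldH Hz.
have [D [q [nzD Dq]]] := common_denominator (nth 0 p) (size p).
have Eq : map_poly frac_poly (\poly_(i < size p) q i) = frac_poly D *: map_poly j p.
  apply/polyP => i; rewrite coefZ !coef_map coef_poly /=.
  case: ltnP => [/Dq -> //|le_i]; by rewrite (nth_default _ le_i) !rmorph0 mulr0.
have nzE : frac_poly D *: map_poly j p != 0.
  by rewrite scaler_eq0 frac_poly_eq0 (negPf nzD) map_poly_eq0.
exists (\poly_(i < size p) q i); last by rewrite Eq rootZ // frac_poly_eq0.
by apply: contraNneq nzE => q0; rewrite -Eq q0 rmorph0.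
Qed.

(** Some multiple of [th] by a nonzero element of K[t] is a polynomial f over L. Were all
    coefficients of f in K, [th] would be in K(t). *)
Lemma polynomial_mem : (exists2 th, H th & forall k, th <> j k) ->
  exists f i, H (T f) /\ forall k, f`_i <> iota k.
Proof.
case=> th Hth nth; have [P nzP Pth] := mem_algebraic Hth.
have [D [f [nzD Df]]] := algebraic_denominator nzP Pth.
exists f; apply: contrapT => nex.
have /choice[k Dk] : forall i, exists k, f`_i = iota k.
  move=> i; apply: contrapT => nk; apply: nex; exists i; split.
    by rewrite -Df; case: fieldH => _ _ _ + _; apply=> //; apply: frac_poly_mem.
  by move=> k Dk; apply: nk; exists k.
have Ef : f = map_poly iota (\poly_(i < size f) k i).
  apply/polyP => i; rewrite coef_map coef_poly /=; case: ifPn => // le_i.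
  by rewrite rmorph0 nth_default // leqNgt.
have /jE[l Dl] : rational th.
  exists (\poly_(i < size f) k i), D; split=> //.
  by rewrite frac_polyE -Ef -Df mulrC mulKf ?frac_poly_eq0.
exact: nth Dl.
Qed.

Lemma mem_coef_span f b i : H (T f) -> b \in bs -> in_span iota ws (f * (Poly ra * b%:P))`_i.
Proof.
move=> Hf bsb; apply: span_const_coef; rewrite !rmorphM -frac_constE.
exact: HW.
Qed.

(* The blocks f_k^Q t^(kQ) ra(t) of f^Q ra do not overlap when Q >= size ra. *)
Lemma mem_coef_span_pchar p f i a b : p \in [pchar L] -> H (T f) ->
  a \in ra -> b \in bs -> in_span iota ws (f`_i ^+ (p ^ size ra) * (a * b)).
Proof.
clear nz_ra; move=> pcharL Hf raa bsb; set Q := (p ^ size ra)%N.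
have pcharL' : p \in [pchar {poly L}] by rewrite (rmorph_pchar (@polyC L)).
have pr_p : prime p by case/andP: pcharL.
have natQ : p.-nat Q by rewrite /Q pnatX pnat_id.
have ltQ : (size ra <= Q)%N by rewrite ltnW // ltn_expl // prime_gt1.
clearbody Q; pose l := index a ra; have ltl : (l < size ra)%N by rewrite index_mem.
have Q_gt0 : (0 < Q)%N by apply: leq_trans ltQ; apply: leq_ltn_trans ltl.
have EfQ : f ^+ Q = \sum_(k < size f) (f`_k ^+ Q)%:P * 'X^(k * Q).
  rewrite -{1}[f]coefK poly_def.
  (* Raising to the power Q is additive, since Q is a power of the characteristic. *)
  rewrite (big_morph (fun g : {poly L} => g ^+ Q) (id1 := 0) (op1 := +%R)); last 2 first.
  - by move=> g1 g2; rewrite exprDn_pchar // (eq_pnat _ (pcharf_eq pcharL')).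
  - by rewrite expr0n gtn_eqF.
  by apply: eq_bigr => k _; rewrite -mul_polyC exprMn -exprM polyC_exp.
have := @mem_coef_span (f ^+ Q) b (i * Q + l); rewrite rmorphXn => /(_ (field_X _ fieldH Hf) bsb).
suff -> : (f ^+ Q * (Poly ra * b%:P))`_(i * Q + l) = f`_i ^+ Q * (a * b) by [].
have Eg k : (Poly ra * b%:P)`_k = ra`_k * b by rewrite coefMC coef_Poly.
rewrite EfQ big_distrl coef_sum /=.
under eq_bigr => k _ do rewrite -mulrA coefCM coefXnM Eg.
(* As l < size ra <= Q, coefficient iQ + l meets only the block k = i: a block with k > i starts
   later, and one with k < i has ended. *)
have F k : k != i -> (if (i * Q + l < k * Q)%N then 0 else ra`_(i * Q + l - k * Q) * b) = 0.
  move=> neki; case: ltnP => // le_k; rewrite nth_default ?mul0r //.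
  have lt_ki : (k < i)%N.
    by rewrite ltn_neqAle neki -ltnS -(ltn_pmul2r Q_gt0) mulSn; lia.
  have : ((k.+1 * Q) <= i * Q)%N by rewrite leq_mul2r lt_ki orbT.
  by rewrite mulSn => le_Q; apply: leq_trans ltQ _; lia.
have [lti|lei] := ltnP i (size f); last first.
  rewrite nth_default // expr0n gtn_eqF // mul0r big1 // => k _.
  by rewrite F ?mulr0 // neq_ltn (leq_trans (ltn_ord k)).
rewrite (bigD1 (Ordinal lti)) //= ltnNge leq_addr /= addKn nth_index // big1 ?addr0 //.
by move=> k neki; rewrite F ?mulr0.
Qed.

Definition eval_poly2 (P : {poly {poly K}}) f := (map_poly (map_poly iota) P).[f].

Lemma frac_eval_poly2 (P : {poly {poly K}}) f :
  T (eval_poly2 P f) = (map_poly frac_poly P).[T f].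
Proof.
rewrite /eval_poly2 -horner_map /= -map_poly_comp; congr (_.[_]).
by apply: eq_map_poly => Q /=; rewrite frac_polyE.
Qed.

(** Chain rule for P(t, f(t)): the first summand differentiates the coefficients of P in t, the
    second the variable replaced by f. *)
Lemma deriv_eval_poly2 (P : {poly {poly K}}) f :
  (eval_poly2 P f)^`() =
  eval_poly2 (map_poly (@deriv K) P) f + eval_poly2 P^`() f * f^`().
Proof.
rewrite /eval_poly2; elim/poly_ind: P => [|P c IHP].
  by rewrite deriv0 !map_poly0 !horner0 deriv0 mul0r addr0.
have -> : map_poly (@deriv K) (P * 'X + c%:P) =
    map_poly (@deriv K) P * 'X + (c^`())%:P.
  apply/polyP => i; rewrite coefD coefMX coefC !coef_map_id0 ?deriv0 //.
  rewrite coefD coefMX coefC.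
  by rewrite derivD; case: i => [|i] /=; rewrite ?deriv0.
rewrite derivMXaddC !rmorphD !rmorphM /= !map_polyX !map_polyC /= !hornerE /=.
rewrite derivD derivM IHP deriv_map; ring.
Qed.

Section PChar0.
Hypothesis pchar0 : [pchar L] =i pred0.

Lemma natr_neq0 (R : nzRingType) (g : {rmorphism R -> L}) n : n.+1%:R != 0 :> R.
Proof.
apply/eqP => /(congr1 g); rewrite rmorph0 rmorph_nat => /eqP.
by move/pcharf0P: pchar0 => ->.
Qed.

(* Differentiating a minimal relation P(f) = 0 expresses f' rationally in f. *)
Lemma deriv_mem f : H (T f) -> H (T f^`()).
Proof.
move=> Hf; have [P0 nzP0 P0f] := mem_algebraic Hf.
pose rel n := `[< exists P : {poly {poly K}},
  [/\ P != 0, size P = n & root (map_poly frac_poly P) (T f)] >].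
have /ex_minnP[n /asboolP[P [nzP szP Pf]] minP] : exists n, rel n.
  by exists (size P0); apply/asboolP; exists P0.
have n_gt1 : (1 < n)%N.
  rewrite -szP ltn_neqAle eq_sym lt0n size_poly_eq0 nzP andbT.
  apply/eqP => /eqP/size_poly1P[c nzc Pc]; move: Pf.
  by rewrite Pc map_polyC rootC frac_poly_eq0 (negPf nzc).
(* In characteristic 0 the coefficient n - 2 of P' is a nonzero multiple of the leading coefficient
   of P. *)
have nzP' : P^`() != 0.
  apply/eqP => /(congr1 (fun Q : {poly {poly K}} => Q`_n.-2)); rewrite coef_deriv coef0.
  have -> : n.-2.+1 = (size P).-1 by rewrite szP; lia.
  have nz_n : ((size P).-1)%:R != 0 :> {poly K}.
    rewrite szP -polyC_natr polyC_eq0.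
    rewrite (_ : n.-1 = n.-2.+1); last by lia.
    exact: (natr_neq0 iota).
  rewrite -mulr_natr => /eqP; rewrite mulf_eq0 (negPf nz_n) orbF.
  by rewrite -/(lead_coef P) lead_coef_eq0 (negPf nzP).
(* P' is shorter than P, so by minimality f is not a root of it, and the chain rule can be solved
   for f'. *)
have nzG : T (eval_poly2 P^`() f) != 0.
  apply/negP => G0; have : (n <= size P^`())%N.
    by apply: minP; apply/asboolP; exists P^`(); split=> //; rewrite /root -frac_eval_poly2.
  by rewrite leqNgt -szP lt_size_deriv.
have := deriv_eval_poly2 P f.
have -> : eval_poly2 P f = 0.
  by apply: frac_inj; rewrite frac_eval_poly2 rmorph0; apply/eqP.
rewrite deriv0 => /(congr1 T)/esym/eqP; rewrite rmorph0 rmorphD rmorphM addrC addr_eq0.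
move=> /eqP Ef; rewrite -(mulKf nzG (T f^`())) Ef mulrC.
case: fieldH => _ _ HN HM HV.
by apply: HM; [apply: HN|apply: HV]; rewrite frac_eval_poly2; apply: horner_mem.
Qed.

Lemma derivn_mem f n : H (T f) -> H (T f^`(n)).
Proof. by move=> Hf; elim: n => [|n IHn]; [rewrite derivn0|rewrite derivnS; apply: deriv_mem]. Qed.

(** If f has size n + 1, its n-th derivative is n! f_n, so the constant f_n is in H; subtracting f_n
    t^n gives a shorter polynomial in H. *)
Lemma coefC_mem f i : H (T f) -> H (T (f`_i)%:P).
Proof.
have H0 : H (T 0) by rewrite rmorph0 -(rmorph0 frac_poly); apply: frac_poly_mem.
have [n] := ubnP (size f); elim: n f => // n IHn f; rewrite ltnS leq_eqVlt.
case/orP=> [/eqP szf Hf|]; last exact: IHn.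
case: n => [|n] in IHn szf *.
  by move/eqP: szf; rewrite size_poly_eq0 => /eqP->; rewrite coef0 polyC0.
have [HK HD HN HM HV] := fieldH.
have Hn : H (T (f`_n)%:P).
  have Efn : f^`(n) = (n`!)%:R * (f`_n)%:P.
    apply/polyP => k; rewrite coef_derivn mulr_natl coefMn !coefC.
    case: k => [|k]; first by rewrite addn0 ffactnn.
    by rewrite nth_default ?szf ?mul0rn //; lia.
  have := derivn_mem n Hf; rewrite Efn rmorphM rmorph_nat => Hnf.
  have nzn : (n`!)%:R != 0 :> M.
    rewrite -(rmorph_nat T) T_eq0 -polyC_natr polyC_eq0.
    by rewrite -(prednK (fact_gt0 n)); apply: (natr_neq0 (idfun : {rmorphism L -> L})).
  rewrite -(mulKf nzn (T _)); apply: HM => //; apply: HV.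
  by rewrite -(rmorph_nat j).
have [-> //|neq_in] := eqVneq i n.
have -> : f`_i = (f - (f`_n)%:P * 'X^n)`_i.
  by rewrite coefB coefCM coefXn (negPf neq_in) mulr0 subr0.
apply: IHn.
  rewrite ltnS; apply/leq_sizeP => k; rewrite leq_eqVlt => /orP[/eqP<-|ltnk].
    by rewrite coefB coefCM coefXn eqxx mulr1 subrr.
  by rewrite coefB coefCM coefXn gtn_eqF // mulr0 subr0 nth_default // szf.
rewrite rmorphB; apply/HD/HN => //; rewrite rmorphM; apply: HM => //.
by have := frac_poly_mem 'X^n; rewrite frac_polyE map_polyXn.
Qed.

Lemma mem_coef_span_pchar0 f i a b : H (T f) ->
  a \in ra -> b \in bs -> in_span iota ws (f`_i * (a * b)).
Proof.
move=> Hf raa bsb; have := mem_coef_span (index a ra) (coefC_mem i Hf) bsb.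
by rewrite coefCM coefMC coef_Poly nth_index.
Qed.

End PChar0.

End Descent.

End RationalFunctions.

(** * A stabilizing element outside K for small products *)

Section WeakKneser.
Variables (K L : fieldType) (iota : {rmorphism K -> L}).

(** The gcd over K of a separable polynomial with root y and X^Q - k becomes, over L, a separable
    divisor of (X - y)^Q with root y. Hence it is X - y up to a scalar, and y is in K. *)
Lemma separable_pchar_root p e y k : p \in [pchar L] ->
  separable_over iota y -> y ^+ (p ^ e) = iota k -> exists k', y = iota k'.
Proof.
move=> pcharL [q [sep_q qy]] Ey; set Q := (p ^ e)%N in Ey.
have pr_p : prime p by case/andP: pcharL.
have pcharL' : p \in [pchar {poly L}] by rewrite (rmorph_pchar (@polyC L)).
have Eexp : map_poly iota ('X^Q - k%:P) = ('X - y%:P) ^+ Q.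
  rewrite rmorphB /= map_polyXn map_polyC /= -Ey polyC_exp -[in LHS](subrK y%:P 'X).
  by rewrite exprDn_pchar ?addrK // (eq_pnat _ (pcharf_eq pcharL')) pnatX pnat_id.
pose g := gcdp q ('X^Q - k%:P).
have Eg : map_poly iota g = gcdp (map_poly iota q) (('X - y%:P) ^+ Q).
  by rewrite -Eexp gcdp_map.
have gy : root (map_poly iota g) y.
  rewrite Eg root_gcd qy /= rootE horner_exp hornerXsubC subrr expr0n.
  by rewrite gtn_eqF // /Q expn_gt0 prime_gt0.
have sep_g : separable_poly (map_poly iota g).
  by rewrite separable_map; apply: dvdp_separable sep_q; apply: dvdp_gcdl.
have /dvdp_exp_XsubCP[n [len Egn]] : map_poly iota g %| ('X - y%:P) ^+ Q.
  by rewrite Eg dvdp_gcdr.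
have n1 : n = 1%N.
  apply/eqP; rewrite eqn_leq; apply/andP; split.
    rewrite leqNgt; apply/negP => lt1n.
    have := dvdp_separable (_ : ('X - y%:P) ^+ 2 %| map_poly iota g) sep_g.
    rewrite (eqp_dvdr _ Egn) dvdp_exp2l // => /(_ isT).
    rewrite expr2 separable_mul => /and3P[_ _].
    by rewrite coprimepp size_XsubC.
  case: n Egn {len} => // /eqp_root/(_ y); by rewrite gy expr0 (negPf (root1 _)).
have szg : size g = 2.
  by rewrite -(size_map_poly iota) (eqp_size Egn) n1 expr1 size_XsubC.
have nzg1 : g`_1 != 0.
  by have := lead_coef_eq0 g; rewrite lead_coefE szg /= => ->; rewrite -size_poly_eq0 szg.
exists (- g`_0 / g`_1); move: gy; rewrite rootE horner_coef size_map_poly szg.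
rewrite big_ord_recl big_ord1 /= !coef_map /= expr0 expr1 mulr1 addr_eq0 => /eqP E.
by rewrite rmorphM fmorphV rmorphN E opprK mulrC mulKf // fmorph_eq0.
Qed.

Hypothesis Hsep : forall x : L, algebraic_over iota x -> separable_over iota x.

(** The field given by [e_transform_at] depends on a vector of A. The generic vector carries all
    basis vectors of A as coefficients of distinct powers of t, so one field treats them
    together. *)
Lemma weak_kneser A B W a b w : (0 < a)%N -> (0 < b)%N ->
  has_dim iota A a -> has_dim iota B b -> has_dim iota W w ->
  (forall x y, A x -> B y -> W (x * y)) -> (w + 2 <= a + b)%N ->
  exists2 th, forall k, th <> iota k & forall x y, A x -> B y -> W (th * (x * y)).
Proof.
move=> a_gt0 b_gt0 [ra [sza [fa Aa]]] [bs [szb [fb Bb]]] [ws [szw [fw Ww]]] ABW le_w.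
pose M : fieldType := {fraction {poly L}}.
pose T : {rmorphism {poly L} -> M} := @FracField.tofrac _.
have T_eq0 f : (T f == 0) = (f == 0) by apply: tofrac_eq0.
have T_frac (z : M) : exists n d : {poly L}, [/\ d != 0, coprimep d n & z = T n / T d].
  exact: fraction_coprime.
have [fp fpE] : exists fp : {rmorphism {poly K} -> M}, forall P, fp P = T (map_poly iota P).
  by exists (T \o map_poly iota).
have [fc fcE] : exists fc : {rmorphism L -> M}, forall x, fc x = T x%:P.
  by exists (T \o polyC).
have [Kt [j jE]] := subfield_embedding (rational_subfield T_eq0 fpE).
clearbody T.
have dim_const s : free_over iota s -> has_dim j (in_span j (map fc s)) (size s).
  by move=> fs; rewrite -(size_map fc); apply/has_dim_span/(free_const T_eq0 fpE fcE jE).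
have [[dA dB] dW] := (dim_const _ fa, dim_const _ fb, dim_const _ fw).
have [W0 WD WZ] := span_subspace j (map fc ws).
have constW x : in_span iota ws x -> in_span j (map fc ws) (fc x).
  apply: (@span_sub _ _ iota (fun x => in_span j (map fc ws) (fc x))) => [|y ys]; last first.
    by apply: span_mem; apply: map_f.
  split=> [|u v Wu Wv|k u Wu]; rewrite ?rmorph0 ?rmorphD ?rmorphM //; first exact: WD.
  have [l El] := frac_poly_rational jE k%:P; move: El.
  by rewrite fpE map_polyC -fcE => ->; apply: WZ.
have AB x y : in_span j (map fc ra) x -> in_span j (map fc bs) y ->
    in_span j (map fc ws) (x * y).
  move=> Ax By; move: x Ax; apply: span_sub => [|_ /mapP[u ru ->]].
    by split=> [|u v Wu Wv|k u Wu]; rewrite ?mul0r ?mulrDl -?mulrA //;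
      [apply: WD|apply: WZ].
  move: y By; apply: span_sub => [|_ /mapP[v bv ->]].
    by split=> [|u' v Wu Wv|k u' Wu]; rewrite ?mulr0 ?mulrDr 1?mulrCA //;
      [apply: WD|apply: WZ].
  by rewrite -rmorphM; apply/constW/Ww/ABW; [apply/Aa|apply/Bb]; apply: span_mem.
have nz_free s : (0 < size s)%N -> free_over iota s -> s`_0 != 0.
  move=> s_gt0 /free_overP fs; apply/eqP => s0.
  have /(fs (fun i => (i == 0)%:R))/(_ 0%N s_gt0)/eqP :
      \sum_(i < size s) iota ((i : nat) == 0)%:R * s`_i = 0.
    rewrite big1 // => -[[|i] /= lti] _; first by rewrite s0 mulr0.
    by rewrite rmorph0 mul0r.
  by rewrite oner_eq0.
have nz_ra : Poly ra != 0.
  apply: contraNneq (nz_free ra _ fa) => [/(congr1 (fun q : {poly L} => q`_0))|].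
    by rewrite coef_Poly coef0 => ->.
  by rewrite sza.
have nz_bs : exists2 u, u \in bs & u != 0.
  by exists bs`_0; [rewrite mem_nth ?szb|rewrite nz_free ?szb].
have Ax : in_span j (map fc ra) (T (Poly ra)).
  have -> : Poly ra = \poly_(i < size ra) ra`_i.
    by apply/polyP => i; rewrite coef_Poly coef_poly; case: ltnP => // /(nth_default 0).
  rewrite poly_def rmorph_sum; apply: subspace_sum; first exact: span_subspace.
  move=> i; rewrite -mul_polyC rmorphM -fcE mulrC.
  have [l El] := frac_poly_rational jE 'X^i; move: El; rewrite fpE map_polyXn => ->.
  have [_ _ AZ] := span_subspace j (map fc ra); apply/AZ/span_mem/map_f/mem_nth.
  exact: ltn_ord.
have nzx : T (Poly ra) != 0 by rewrite T_eq0.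
have [|H [fH thH HBW]] := e_transform_at dA dB dW Ax nzx AB; first by rewrite sza szb szw.
have HW h u : H h -> u \in bs ->
    in_span j (map fc ws) (h * (T (Poly ra) * fc u)).
  by move=> Hh bu; apply: HBW => //; apply: span_mem; apply: map_f.
have [f [i [Hf nKf]]] :=
  polynomial_mem T_eq0 fpE jE T_frac fH HW nz_ra nz_bs thH.
(* By bilinearity it is enough to treat products of basis vectors. *)
suff [th nKth thW] : exists2 th, forall k, th <> iota k
    & forall x y, x \in ra -> y \in bs -> in_span iota ws (th * (x * y)).
  have [V0 VD VZ] := span_subspace iota ws.
  exists th => // x y /Aa ax /Bb bx; apply/Ww; move: x ax.
  apply: span_sub => [|u ru].
    split=> [|u v Wu Wv|k u Wu]; first by rewrite mul0r mulr0.
      by rewrite mulrDl mulrDr; apply: VD.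
    by rewrite -mulrA mulrCA; apply: VZ.
  move: y bx; apply: span_sub => [|v bv]; last exact: thW.
  split=> [|u' v Wu Wv|k u' Wu]; first by rewrite !mulr0.
    by rewrite !mulrDr; apply: VD.
  by rewrite (mulrCA u) (mulrCA th); apply: VZ.
have [[p pcharL]|pchar0] := pselect (exists p, p \in [pchar L]); last first.
  have {}pchar0 : [pchar L] =i pred0.
    by move=> p; apply/negP => pL; apply: pchar0; exists p.
  exists f`_i => // x y rx by_.
  exact: (mem_coef_span_pchar0 T_eq0 fpE fcE jE fH HW nz_ra nz_bs pchar0).
exists (f`_i ^+ (p ^ size ra)) => [k Ek|x y rx by_]; last first.
  exact: (mem_coef_span_pchar T_eq0 fpE fcE jE fH HW).
have p_gt0 : (0 < p ^ size ra)%N by rewrite expn_gt0 prime_gt0 //; case/andP: pcharL.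
(* If f_i^Q were in K, then f_i would be algebraic, hence separable, hence in K. *)
have [|k' Ek'] := separable_pchar_root pcharL _ Ek; last exact: nKf Ek'.
apply: Hsep; exists ('X^(p ^ size ra) - k%:P); split.
  by rewrite -size_poly_gt0 size_XnsubC.
by rewrite rmorphB /= map_polyXn map_polyC rootE !hornerE Ek subrr.
Qed.

End WeakKneser.

(** * The linear Kneser theorem *)

Section Kneser.
Variables (K L : fieldType) (iota : {rmorphism K -> L}).

Lemma prod_span_subspace A B : subspace iota (prod_span iota A B).
Proof.
split.
- by exists [::]; split=> //; case: (span_subspace iota [::]).
- move=> x y [s [sAB sx]] [t [tAB ty]]; exists (s ++ t); split=> [z|].
    by rewrite mem_cat => /orP[/sAB|/tAB].
  by apply/in_span_cat; exists x, y.
- move=> k x [s [sAB sx]]; exists s; split=> //.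
  by case: (span_subspace iota s) => _ _; apply.
Qed.

Lemma prod_span_mul A B x y : A x -> B y -> prod_span iota A B (x * y).
Proof.
move=> Ax By; exists [:: x * y]; split; last by apply: span_mem; rewrite inE.
by move=> z; rewrite inE => /eqP->; exists x, y.
Qed.

Lemma prod_span_min A B V : subspace iota V ->
  (forall x y, A x -> B y -> V (x * y)) -> contains (prod_span iota A B) V.
Proof.
move=> sV ABV x [s [sAB sx]]; apply: (span_sub sV) sx => y /sAB[u [v [Au [Bv ->]]]].
exact: ABV.
Qed.

Hypothesis Hsep : forall x : L, algebraic_over iota x -> separable_over iota x.

(** H is finite over K, so an x algebraic over H is algebraic, hence separable, over K; its
    separable polynomial can be read over H. *)
Lemma separable_tower H h (F : fieldType) (j : {rmorphism F -> L}) :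
  intermediate_field iota H -> has_dim iota H h ->
  (forall x, H x <-> exists k, x = j k) ->
  forall x, algebraic_over j x -> separable_over j x.
Proof.
move=> fH dH HE x [p [nzp px]].
have [HK HD HN HM HV] := fH.
have intH y : H y -> integralOver iota y.
  move=> Hy; have [//|q [nzq qy]] := @has_dim_algebraic _ _ iota H h y dH.
    by move=> i; apply: field_X.
  by apply/integral_algebraic; exists q.
have [q [sep_q qx]] : separable_over iota x.
  apply: Hsep; have [|q nzq qx] := (integral_algebraic iota x).2; last by exists q.
  apply: (@integral_root _ _ _ (map_poly j p)) => //; first by rewrite map_poly_eq0.
  move=> y /(nthP 0)[i _ <-]; rewrite coef_map; apply: intH; apply/HE.
  by exists p`_i.
have /choice[g Dg] : forall k, exists l, iota k = j l by move=> k; apply/HE.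
exists (\poly_(i < size q) g q`_i).
suff Eq : map_poly j (\poly_(i < size q) g q`_i) = map_poly iota q.
  by rewrite -(separable_map j) Eq separable_map.
apply/polyP => i; rewrite !coef_map coef_poly /=; case: ifPn => [_|le_i]; first by rewrite Dg.
by rewrite (nth_default _ (_ : size q <= i)%N) ?rmorph0 // leqNgt.
Qed.

Lemma ceil_le r h d : (0 < h)%N -> (r <= d * h)%N -> ((r + h).-1 %/ h <= d)%N.
Proof. by move=> h_gt0 le_r; rewrite -ltnS ltn_divLR // mulSn; lia. Qed.

(* The linear Kneser theorem; H is the stabilizer of <AB>. *)
Lemma kneser A B r s m : (0 < r)%N -> (0 < s)%N ->
  has_dim iota A r -> has_dim iota B s -> has_dim iota (prod_span iota A B) m ->
  exists (H : L -> Prop) h,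
    [/\ intermediate_field iota H, has_dim iota H h & (kappa_term r s h <= m)%N].
Proof.
move=> r_gt0 s_gt0 dA dB dW; set W := prod_span iota A B in dW.
have fH := stabilizer_field dW; set H := stabilizer W in fH.
have [a0 Aa0 nza0] := has_dim_neq0 dA r_gt0.
have [b0 Bb0 nzb0] := has_dim_neq0 dB s_gt0.
(* Multiplication by a0 b0 maps H into W, so H has finite dimension. *)
have nzw : (a0 * b0)^-1 != 0 by rewrite invr_eq0 mulf_neq0.
have sHW : contains H (fun x => W (x / (a0 * b0)^-1)).
  by move=> x Hx; rewrite invrK; apply/Hx/prod_span_mul.
have [h dH _] := has_dim_subdim (field_subspace fH) sHW (has_dim_scale nzw dW).
have [HK HD HN HM HV] := fH.
have H1 : H 1 by rewrite -(rmorph1 iota).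
have h_gt0 := has_dim_gt0 dH H1 (oner_neq0 _).
have [F [j HE]] := subfield_embedding (intermediate_subfield fH).
have [W0 WD _] := has_dim_subspace dW.
have sW : subspace j W.
  by split=> // k x Wx; have /(_ x Wx) : H (j k) by apply/HE; exists k.
case: (dA) (dB) (dW) => ra [sza [fa Aa]] [bs [szb [fb Bb]]] [ws [szw [fw Ww]]].
(* The F-spans of [ra] and [bs] are HA and HB; a1, b1 and w1 are the F-dimensions of HA, HB and
   W. *)
have [a1 dA1 _] := @has_dim_sub _ _ j _ ra (span_subspace j ra) (fun x Hx => Hx).
have [b1 dB1 _] := @has_dim_sub _ _ j _ bs (span_subspace j bs) (fun x Hx => Hx).
have [w1 dW1 _] : exists2 w1, has_dim j W w1 & (w1 <= size ws)%N.
  by apply: has_dim_sub => // x /Ww; apply: (span_tower HE HK).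
have AA1 : contains A (in_span j ra) by move=> x /Aa; apply: (span_tower HE HK).
have BB1 : contains B (in_span j bs) by move=> x /Bb; apply: (span_tower HE HK).
have le_r : (r <= a1 * h)%N by apply: has_dim_le AA1 dA (tower_dim HE dH dA1).
have le_s : (s <= b1 * h)%N by apply: has_dim_le BB1 dB (tower_dim HE dH dB1).
have Em : m = (w1 * h)%N by apply: has_dim_unique dW (tower_dim HE dH dW1).
have a1_gt0 : (0 < a1)%N by case: (a1) le_r => //; rewrite mul0n leqn0 gtn_eqF.
have b1_gt0 : (0 < b1)%N by case: (b1) le_s => //; rewrite mul0n leqn0 gtn_eqF.
have AB1 x y : in_span j ra x -> in_span j bs y -> W (x * y).
  have [_ _ WZ] := sW; move=> Ax By; move: x Ax; apply: span_sub => [|u ru].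
    split=> [|u v Wu Wv|k u Wu]; first by rewrite mul0r.
      by rewrite mulrDl; apply: WD.
    by rewrite -mulrA; apply: WZ.
  move: y By; apply: span_sub => [|v bv].
    split=> [|u' v Wu Wv|k u' Wu]; first by rewrite mulr0.
      by rewrite mulrDr; apply: WD.
    by rewrite mulrCA; apply: WZ.
  by apply: prod_span_mul; [apply/Aa|apply/Bb]; apply: span_mem.
exists H, h; split=> //; rewrite Em leq_mul2r; apply/orP; right.
(* The ceilings of r/h and s/h are at most a1 and b1, so w1 >= a1 + b1 - 1 is enough. *)
have le_a := ceil_le h_gt0 le_r; have le_b := ceil_le h_gt0 le_s.
suff: (a1 + b1 < w1 + 2)%N by move: le_a le_b; lia.
(* Otherwise [weak_kneser] over F yields an element outside H that stabilizes W. *)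
rewrite ltnNge; apply/negP => le_w.
have [th nHth thW] := weak_kneser (separable_tower fH dH HE) a1_gt0 b1_gt0
  dA1 dB1 dW1 AB1 le_w.
suff /HE[k] : H th by apply: nHth.
apply: prod_span_min => [|x y Ax By]; last by apply: thW; [apply: AA1|apply: BB1].
have [_ _ WZ] := has_dim_subspace dW; split; first by rewrite mulr0.
  by move=> x y Wx Wy; rewrite mulrDr; apply: WD.
by move=> k x Wx; rewrite mulrCA; apply: WZ.
Qed.

End Kneser.

(** * Primitive elements, over finite and infinite base fields *)

Lemma unity_root_primitive (L : fieldType) (y1 y2 : L) n1 n2 :
  (0 < n1)%N -> (0 < n2)%N -> y1 ^+ n1 = 1 -> y2 ^+ n2 = 1 ->
  exists i j, exists2 z, z = y1 ^+ i * y2 ^+ j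
    & exists k1 k2, y1 = z ^+ k1 /\ y2 = z ^+ k2.
Proof.
move=> n1_gt0 n2_gt0 y1n y2n.
(* These products form a finite subgroup of the multiplicative group of L, which is therefore
   cyclic; z will be a generator. *)
pose rs := undup [seq y1 ^+ i * y2 ^+ j | i <- iota 0 n1, j <- iota 0 n2].
have rsP x : reflect (exists i j, x = y1 ^+ i * y2 ^+ j) (x \in rs).
  rewrite mem_undup; apply: (iffP allpairsP) => [[[i j] [_ _ ->]]|[i [j ->]]].
    by exists i, j.
  exists (i %% n1, j %% n2)%N; rewrite !mem_iota !add0n !ltn_mod n1_gt0 n2_gt0.
  by rewrite !expr_mod.
have nz_rs x : x \in rs -> x != 0.
  case/rsP=> i [j ->]; apply/mulf_neq0; apply/expf_neq0; apply/eqP => y0.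
    by move/eqP: y1n; rewrite y0 expr0n gtn_eqF // eq_sym oner_eq0.
  by move/eqP: y2n; rewrite y0 expr0n gtn_eqF // eq_sym oner_eq0.
have uniq_rs : uniq rs by apply: undup_uniq.
have rs_gt0 : (0 < size rs)%N.
  have: 1 \in rs by apply/rsP; exists 0%N, 0%N; rewrite !expr0 mulr1.
  by case: (rs).
have unity x : x \in rs -> x ^+ size rs = 1.
  move=> xrs; have nzx := nz_rs x xrs.
  (* Multiplication by x permutes [rs]; comparing the products of all elements gives x^|rs| = 1. *)
  have uniq_x : uniq [seq x * y | y <- rs] by rewrite map_inj_uniq //; apply: mulfI.
  have sub_x : {subset [seq x * y | y <- rs] <= rs}.
    move=> _ /mapP[y yrs ->]; case/rsP: xrs yrs => i [j ->] /rsP[i' [j' ->]].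
    by apply/rsP; exists (i + i')%N, (j + j')%N; rewrite !exprD mulrACA.
  have [_ eq_x] := uniq_min_size uniq_x sub_x (eq_leq (esym (size_map _ _))).
  have : \prod_(y <- [seq x * y | y <- rs]) y = \prod_(y <- rs) y.
    by apply/perm_big/uniq_perm.
  rewrite big_map big_split /= big_const_seq.
  rewrite count_predT iter_mulr_1 -[RHS]mul1r; apply: mulIf.
  rewrite prodf_seq_neq0; apply/allP => y yrs; exact: nz_rs.
have /hasP[z /rsP[i [j Dz]] prim_z] : has (size rs).-primitive_root rs.
  apply: has_prim_root => //; apply/allP => x xrs; rewrite unity_rootE; apply/eqP.
  exact: unity.
have rs1 : y1 \in rs by apply/rsP; exists 1%N, 0%N; rewrite expr0 mulr1.
have rs2 : y2 \in rs by apply/rsP; exists 0%N, 1%N; rewrite expr0 mul1r.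
exists i, j, z => //.
have [k1 D1] := prim_rootP prim_z (unity _ rs1).
have [k2 D2] := prim_rootP prim_z (unity _ rs2).
by exists k1, k2.
Qed.

Section PrimitiveElement.
Variables (K L : fieldType) (iota : {rmorphism K -> L}).
Implicit Types (x y z : L).

Definition in_simple z w := exists q : {poly K}, (map_poly iota q).[z] = w.

Lemma in_simple_trans z y w : in_simple z y -> in_simple y w -> in_simple z w.
Proof.
by move=> [p <-] [q <-]; exists (q \Po p); rewrite map_comp_poly horner_comp.
Qed.

(** K is finite, listed by [ks]. Each y^i is determined by the coefficients of X^i mod p, stored as
    indices into [ks]; these form a finite type, so two powers of y agree. *)
Lemma algebraic_unity_root (ks : seq K) y :
  (forall k, k \in ks) -> algebraic_over iota y -> y != 0 ->
  exists2 n, (0 < n)%N & y ^+ n = 1.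
Proof.
move=> Kks [p [nzp py]] nzy; pose N := size p; pose m := size ks.
have /choice[g Dg] : forall i, exists u : {ffun 'I_N -> 'I_m.+1},
    y ^+ i = \sum_(k < N) iota ks`_(u k) * y ^+ k.
  move=> i; pose q := 'X^i %% p.
  exists [ffun k : 'I_N => inord (index q`_k ks)].
  transitivity (map_poly iota q).[y].
    have := congr1 (fun u : {poly K} => (map_poly iota u).[y]) (divp_eq 'X^i p).
    by rewrite rmorphD rmorphM /= map_polyXn hornerXn hornerD hornerM (rootP py) mulr0 add0r.
  rewrite (@horner_coef_wide _ N); last by rewrite size_map_poly ltnW // ltn_modp.
  apply: eq_bigr => k _; rewrite ffunE inordK ?nth_index ?coef_map //.
  by rewrite ltnS ltnW // index_mem.
have : ~~ injectiveb (fun i : 'I_#|{ffun 'I_N -> 'I_m.+1}|.+1 => g i).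
  by apply/negP => /injectiveP/leq_card; rewrite card_ord ltnn.
case/injectivePn=> i1 [i2 ne12 Eg].
wlog lt12 : i1 i2 ne12 Eg / (i1 < i2)%N.
  move=> IH; move: ne12; rewrite -val_eqE neq_ltn => /orP[lt|lt].
    by apply: (IH i1 i2) => //; rewrite -val_eqE ltn_eqF.
  by apply: (IH i2 i1) => //; rewrite -val_eqE ltn_eqF.
exists (i2 - i1)%N; first by rewrite subn_gt0.
apply: (mulIf (expf_neq0 i1 nzy)); rewrite mul1r -exprD subnK ?(ltnW lt12) //.
by rewrite Dg [RHS]Dg Eg.
Qed.

Lemma algebraic_X y n : algebraicOver iota y -> algebraicOver iota (y ^+ n).
Proof.
move=> alg_y; elim: n => [|n IHn]; first by rewrite expr0; apply: algebraic1.
by rewrite exprS; apply: algebraic_mul.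
Qed.

Lemma in_simpleX z n : in_simple z (z ^+ n).
Proof. by exists 'X^n; rewrite map_polyXn hornerXn. Qed.

Hypothesis Hsep : forall x : L, algebraic_over iota x -> separable_over iota x.

(** If some t in K is not a root of the polynomial r, then t y2 - y1 works. Otherwise K is finite,
    and y1, y2 are zero or roots of unity, which are powers of a common one. *)
Lemma primitive_pair y1 y2 : algebraic_over iota y1 -> algebraic_over iota y2 ->
  exists z, [/\ algebraic_over iota z, in_simple z y1 & in_simple z y2].
Proof.
move=> alg1 alg2; have [p1 [nzp1 p1y]] := alg1.
have [q [sep_q qy]] := Hsep alg2.
have [r nzr PETr] := large_field_PET nzp1 p1y qy sep_q.
have algO y : algebraic_over iota y <-> algebraicOver iota y.
  by split=> [[p [? ?]]|[p ? ?]]; exists p.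
have [[t nrt]|allr] := pselect (exists t, ~~ root r (iota t)).
  have [in1 in2] := PETr t nrt; exists (iota t * y2 - y1); split=> //.
  apply/algO/algebraic_sub; last exact/algO.
  by apply: algebraic_mul; [apply: algebraic_id|apply/algO].
have rt t : root r (iota t) by apply: contrapT => /negP ?; apply: allr; exists t.
(* Every element of K maps to a root of the nonzero polynomial r, so K is finite. *)
have [ks Kks] : exists ks : seq K, forall k, k \in ks.
  apply: contrapT => nfin.
  have [s us szs] : exists2 s : seq K, uniq s & size s = size r.
    elim: (size r) => [|n [s us szs]]; first by exists [::].
    have [k nks] : exists k, k \notin s.
      apply: contrapT => nk; apply: nfin; exists s => k.
      by apply: contrapT => /negP ?; apply: nk; exists k.
    by exists (k :: s); rewrite /= ?nks ?szs.
  have : (size (map iota s) < size r)%N.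
    apply: max_poly_roots => //; first by apply/allP => _ /mapP[k _ ->].
    by rewrite map_inj_uniq //; apply: fmorph_inj.
  by rewrite size_map szs ltnn.
have [-> | nz1] := eqVneq y1 0.
  by exists y2; split=> //; [exists 0; rewrite rmorph0 horner0|exact: (in_simpleX y2 1)].
have [-> | nz2] := eqVneq y2 0.
  by exists y1; split=> //; [exact: (in_simpleX y1 1)|exists 0; rewrite rmorph0 horner0].
have [n1 n1_gt0 y1n] := algebraic_unity_root Kks alg1 nz1.
have [n2 n2_gt0 y2n] := algebraic_unity_root Kks alg2 nz2.
have [i [j [z Dz [k1 [k2 [D1 D2]]]]]] := unity_root_primitive n1_gt0 n2_gt0 y1n y2n.
exists z; split; last 2 first.
- by rewrite D1; apply: in_simpleX.
- by rewrite D2; apply: in_simpleX.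
by apply/algO; rewrite Dz; apply: algebraic_mul; apply: algebraic_X; apply/algO.
Qed.

Lemma primitive_seq (ys : seq L) : (forall y, y \in ys -> algebraic_over iota y) ->
  exists2 z, algebraic_over iota z & forall y, y \in ys -> in_simple z y.
Proof.
elim: ys => [_|y ys IHys alg_ys].
  by exists 0 => //; exists 'X; rewrite polyX_eq0 map_polyX rootE hornerX.
have [|z alg_z zys] := IHys; first by move=> x xs; apply: alg_ys; rewrite inE xs orbT.
have [|z' [alg_z' z'y z'z]] := @primitive_pair y z _ alg_z.
  by apply: alg_ys; rewrite inE eqxx.
exists z' => // x; rewrite inE => /predU1P[->//|/zys]; exact: in_simple_trans.
Qed.

(** If this failed for all x, every element of L would have degree below m. A primitive element z
    for m free vectors would then put them all in K[z], of dimension below m. *)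
Lemma free_powers m : dim_ge iota m ->
  exists x, free_over iota (mkseq (fun i => x ^+ i) m).
Proof.
case=> ys [szy fy]; apply: contrapT => nfree.
have nonfree x : exists p : {poly K},
    [/\ p != 0, (size p <= m)%N & root (map_poly iota p) x].
  apply: (@nonfree_powers _ _ iota m x 1) => [|fx]; first exact: oner_neq0.
  apply: nfree; exists x; congr (free_over _ _): fx.
  by apply: eq_map => i; rewrite mulr1.
have [y _|z _ z_ys] := @primitive_seq ys.
  by have [p [nzp _ py]] := nonfree y; exists p.
have [p [nzp szp pz]] := nonfree z; pose n := (size p).-1.
have szpn : size p = n.+1 by rewrite prednK // size_poly_gt0.
have : (size ys <= size (mkseq (fun i => z ^+ i) n))%N.
  apply: (free_size_le fy) => y /z_ys[q <-].
  have -> : (map_poly iota q).[z] = (map_poly iota (q %% p)).[z].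
    by rewrite {1}(divp_eq q p) rmorphD rmorphM /= hornerD hornerM (rootP pz) mulr0 add0r.
  rewrite (@horner_coef_wide _ n); last by rewrite size_map_poly -ltnS -szpn ltn_modp.
  apply: subspace_sum; first exact: span_subspace.
  move=> i; have [_ _ sZ] := span_subspace iota (mkseq (fun i => z ^+ i) n).
  by rewrite coef_map; apply/sZ/span_mem/mapP; exists (i : nat); rewrite ?mem_iota /=.
by rewrite size_mkseq szy; move: szp; rewrite szpn; lia.
Qed.

End PrimitiveElement.

(** * The upper bound from spaces spanned by powers *)

Section UpperBound.
Variables (K L : fieldType) (iota : {rmorphism K -> L}).
Hypothesis Hsep : forall x : L, algebraic_over iota x -> separable_over iota x.

Lemma le_ceil r h : (0 < h)%N -> (r <= (r + h).-1 %/ h * h)%N.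
Proof.
by move=> h_gt0; have := divn_eq (r + h).-1 h; have := ltn_pmod (r + h).-1 h_gt0; lia.
Qed.

(** The F-span of r vectors free over K has a dimension a1 with r <= a1 h, hence ceil(r/h) <= a1. *)
Lemma dim_ge_tower H h (F : fieldType) (j : {rmorphism F -> L}) r :
  intermediate_field iota H -> has_dim iota H h -> (0 < h)%N ->
  (forall x, H x <-> exists k, x = j k) ->
  dim_ge iota r -> dim_ge j ((r + h).-1 %/ h).
Proof.
move=> [HK _ _ _ _] dH h_gt0 HE [b [szb fb]].
have [a1 dA1 _] := @has_dim_sub _ _ j _ b (span_subspace j b) (fun x Hx => Hx).
have le_r : (r <= a1 * h)%N.
  rewrite -szb; apply: has_dim_le (has_dim_span fb) (tower_dim HE dH dA1).
  exact: (span_tower HE HK).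
have [vs [szv [fv _]]] := dA1; exists (take ((r + h).-1 %/ h) vs); split.
  by rewrite size_takel // szv; apply: ceil_le.
exact: free_take.
Qed.

(** An inequality suffices: for a minimizing H the lower bound of [kneser] turns it into an
    equality. *)
Lemma kappa_term_attained H h r s : intermediate_field iota H -> has_dim iota H h ->
  (0 < r)%N -> (0 < s)%N -> dim_ge iota r -> dim_ge iota s ->
  exists (A B : L -> Prop) m, [/\ has_dim iota A r, has_dim iota B s,
    has_dim iota (prod_span iota A B) m & (m <= kappa_term r s h)%N].
Proof.
move=> fH dH r_gt0 s_gt0 dr ds; have [HK HD HN HM HV] := fH.
have H1 : H 1 by rewrite -(rmorph1 iota).
have h_gt0 := has_dim_gt0 dH H1 (oner_neq0 _).
have [F [j HE]] := subfield_embedding (intermediate_subfield fH).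
pose P x n := mkseq (fun i => x ^+ i : L) n.
set c := ((r + h).-1 %/ h)%N; set d := ((s + h).-1 %/ h)%N.
have dc : dim_ge j c by apply: (dim_ge_tower fH dH h_gt0 HE dr).
have dd : dim_ge j d by apply: (dim_ge_tower fH dH h_gt0 HE ds).
(* One x serves both lists, since the shorter list of powers is a prefix of the longer. *)
have [x [fc fd]] : exists x, free_over j (P x c) /\ free_over j (P x d).
  have take_P x m n : (m <= n)%N -> P x m = take m (P x n).
    by move=> le_mn; rewrite /P /mkseq -map_take take_iota (minn_idPl le_mn).
  have sepj := separable_tower Hsep fH dH HE.
  have [le_cd|/ltnW le_dc] := leqP c d.
    have [x fx] := free_powers sepj dd; exists x; split=> //.
    by rewrite (take_P _ _ _ le_cd); apply: free_take.
  have [x fx] := free_powers sepj dc; exists x; split=> //.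
  by rewrite (take_P _ _ _ le_dc); apply: free_take.
(* The F-span has a K-basis of nh vectors; the first t of them span the required subspace. *)
have sub n t : free_over j (P x n) -> (t <= n * h)%N ->
    exists2 A, has_dim iota A t & contains A (in_span j (P x n)).
  move=> fn le_t; have [b [szb fb Eb]] := tower_span HE dH fn.
  exists (in_span iota (take t b)).
    have := has_dim_span (free_take (n := t) fb); rewrite size_takel //.
    by rewrite szb size_mkseq.
  apply: span_sub => [|y /mem_take/span_mem/Eb //].
  have [s0 sD sZ] := span_subspace iota b.
  by split=> [|u v /Eb bu /Eb bv|k u /Eb bu]; apply/Eb => //; [apply: sD|apply: sZ].
have [A dA sA] := sub _ _ fc (le_ceil r h_gt0).
have [B dB sB] := sub _ _ fd (le_ceil s h_gt0).
have c_gt0 : (0 < c)%N.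
  by have := le_ceil r h_gt0; rewrite -/c; case: (c) => //; rewrite mul0n leqNgt r_gt0.
have d_gt0 : (0 < d)%N.
  by have := le_ceil s h_gt0; rewrite -/d; case: (d) => //; rewrite mul0n leqNgt s_gt0.
(* Products of the two F-spans involve only the powers 1, x, ..., x^(c+d-2). *)
pose V := in_span j (P x (c + d).-1).
have [V0 VD VZ] := span_subspace j (P x (c + d).-1).
have [n dV le_n] : exists2 n, has_dim j V n & (n <= (c + d).-1)%N.
  by rewrite -(size_mkseq (fun i => x ^+ i) (c + d).-1); apply: has_dim_sub.
have dV' := tower_dim HE dH dV.
have mulV y z : in_span j (P x c) y -> in_span j (P x d) z -> V (y * z).
  move=> Py Pz; move: y Py; apply: span_sub => [|_ /mapP[i + ->]].
    split=> [|u v Wu Wv|k u Wu]; first by rewrite mul0r.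
      by rewrite mulrDl; apply: VD.
    by rewrite -mulrA; apply: VZ.
  rewrite mem_iota => /= lti; move: z Pz; apply: span_sub => [|_ /mapP[l + ->]].
    split=> [|u v Wu Wv|k u Wu]; first by rewrite mulr0.
      by rewrite mulrDr; apply: VD.
    by rewrite mulrCA; apply: VZ.
  rewrite mem_iota => /= ltl; rewrite -exprD; apply/span_mem/mapP.
  by exists (i + l)%N => //; rewrite mem_iota /=; lia.
have sAB : contains (prod_span iota A B) V.
  apply: prod_span_min => [|y z Ay Bz]; first exact: has_dim_subspace dV'.
  by apply: mulV; [apply: sA|apply: sB].
have [m dAB le_m] := has_dim_subdim (prod_span_subspace iota A B) sAB dV'.
exists A, B, m; split=> //; apply: leq_trans le_m _.
by rewrite /kappa_term leq_mul2r le_n orbT.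
Qed.

End UpperBound.

(** * Equality of the two minima *)

Theorem theorem1p1 (K L : fieldType) (iota : {rmorphism K -> L})
  (Hsep : forall x : L, algebraic_over iota x -> separable_over iota x)
  (r s : nat) (hr : (0 < r)%N) (hs : (0 < s)%N)
  (hrL : dim_ge iota r) (hsL : dim_ge iota s) :
  exists n : nat, is_mu iota r s n /\ is_kappa iota r s n.
Proof.
pose attained n := `[< exists (H : L -> Prop) h,
  [/\ intermediate_field iota H, has_dim iota H h & n = kappa_term r s h] >].
have ex_attained : exists n, attained n.
  (* The choice H = K, h = 1 shows that the minimum is over a nonempty set. *)
  exists (kappa_term r s 1); apply/asboolP; exists (fun x => exists k, x = iota k), 1%N.
  split=> //.
    split=> [k|_ _ [k ->] [l ->]|_ [k ->]|_ _ [k ->] [l ->]|_ [k ->]].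
    - by exists k.
    - by exists (k + l); rewrite rmorphD.
    - by exists (- k); rewrite rmorphN.
    - by exists (k * l); rewrite rmorphM.
    - by exists k^-1; rewrite fmorphV.
  apply: has_dim_ext (has_dim_span (@free1 _ _ iota 1 (oner_neq0 _))) => x.
  by rewrite in_span1; split=> -[k ->]; exists k; rewrite mulr1.
have [n /asboolP[H [h [fH dH Dn]]] min_n] := ex_minnP ex_attained.
have kappa_le H' h' : intermediate_field iota H' -> has_dim iota H' h' ->
    (n <= kappa_term r s h')%N.
  by move=> fH' dH'; apply: min_n; apply/asboolP; exists H', h'.
have mu_ge A B m : has_dim iota A r -> has_dim iota B s ->
    has_dim iota (prod_span iota A B) m -> (n <= m)%N.
  move=> dA dB dAB; have [H' [h' [fH' dH' le_m]]] := kneser Hsep hr hs dA dB dAB.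
  exact: leq_trans (kappa_le _ _ fH' dH') le_m.
exists n; split; last by split=> //; exists H, h.
split=> //; have [A [B [m [dA dB dAB le_m]]]] := kappa_term_attained Hsep fH dH hr hs hrL hsL.
(* The lower bound gives n <= m, and the construction at the minimizing H gives m <= n. *)
exists A, B; split=> //; suff -> : n = m by [].
by apply/eqP; rewrite eqn_leq (mu_ge _ _ _ dA dB dAB) Dn.
Qed.
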